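(* For every colored tableau $T$ (for the natural order, of straight shape) whose southwest entry is barred, $T^{\mathrm{blft}}=C_-(T)^{\mathrm{blft}}$, where $C_-(T)$ is obtained from $T$ by removing the bar from its southwest entry.
   Context: Alphabet: $\mathcal A$ consists of unbarred letters $1,2,\dots$ and barred letters $\bar1,\bar2,\dots$. The natural order is $\bar1<1<\bar2<2<\cdots$; the small bar order is $\bar1\prec\bar2\prec\cdots\prec1\prec2\prec\cdots$. Ties between equal letters are broken by standardization: in tableaux, equal unbarred letters are regarded as increasing left to right and equal barred letters as increasing bottom to top. Colored tableau for a total order $\lessdot$ on $\mathcal A$: a filling of a Young diagram (English notation) by letters of $\mathcal A$ whose rows and columns weakly increase for $\lessdot$, with no unbarred letter repeated in a column and no barred letter repeated in a row. The southwest entry is the entry in the bottom cell of the first column. (Removing the bar of the southwest entry of a colored tableau for the natural order yields again such a colored tableau.) Conversion: for $k\ge1$ let $<^k$ be the order $\bar1<^k\cdots<^k\bar k<^k1<^k\cdots<^kk<^k\overline{k+1}<^kk+1<^k\overline{k+2}<^k\cdots$ ($<^1$ is the natural order). For a colored tableau $T$ for $<^k$, $\mathrm{conv}_{<^k\to<^{k+1}}(T)$ is obtained by taking occurrences of $\overline{k+1}$ one at a time from bottommost to topmost and, for each, repeatedly exchanging it with the greater (in $<^{k+1}$, where $\overline{k+1}$ is below $1,\dots,k$) of its neighbors above and to its left as long as it is smaller than one of them. $\mathrm{conv}_{<\to\prec}(T)$ applies these successively for $k=1,2,\dots,m$ with $m$ at least the largest letter; it is a colored tableau for $\prec$. For a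 colored tableau $T$, let $T'=\mathrm{conv}_{<\to\prec}(T)$, let $\mathrm{sub}_{\bar{}}(T')$ be its subtableau of barred entries and $\mathrm{sub}_\varnothing(T')$ its skew subtableau of unbarred entries, and let $\mathrm{sub}_{\bar{}}(T')^*$ be the transpose of $\mathrm{sub}_{\bar{}}(T')$ with bars removed. Then $T^{\mathrm{blft}}$ is the unique ordinary semistandard straight-shape tableau Knuth equivalent to $\mathrm{rowword}(\mathrm{sub}_{\bar{}}(T')^* )\,\mathrm{rowword}(\mathrm{sub}_\varnothing(T'))$, where rowword reads rows from bottom to top.
   Formalization: In the conversion, the occurrences of each barred letter k+1 are taken from topmost to bottommost rather than bottommost to topmost; in the stated order the claim fails, e.g. for T with rows (1, bar 2) and (bar 2, bar 3). *)

(* Defs.v *)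
From Stdlib Require Import ClassicalEpsilon.
From mathcomp Require Import all_boot.
From mathcomp Require Import zify.

Set Implicit Arguments.
Unset Strict Implicit.
Unset Printing Implicit Defensive.

(* Fillings of Young diagrams in English notation: the list of the rows from
   top to bottom, each row listed from left to right; cell (i, j) is in row i
   and column j, both numbered from 0. *)
Section Fillings.
Variables (A : Type) (x0 : A).
Implicit Type T : seq (seq A).

Definition straight T : bool := sorted geq (shape T) && (0 \notin shape T).

Definition in_diagram T (c : nat * nat) : bool := c.2 < size (nth [::] T c.1).

Definition entry T (c : nat * nat) : A := nth x0 (nth [::] T c.1) c.2.

Definition set_entry T (c : nat * nat) (x : A) : seq (seq A) :=
  set_nth [::] T c.1 (set_nth x0 (nth [::] T c.1) c.2 x).

Definition exchange T (c d : nat * nat) : seq (seq A) :=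
  set_entry (set_entry T c (entry T d)) d (entry T c).

Definition transpose T : seq (seq A) :=
  mkseq (fun j => [seq nth x0 r j | r <- T & j < size r]) (size (head [::] T)).

Definition rowword T : seq A := flatten (rev T).

End Fillings.

(* (true, n) is the barred letter n and (false, n) the unbarred letter n.
   The alphabet consists of the letters with n > 0; this is required in
   [colored_tableau]. *)
Definition letter : Type := (bool * nat)%type.
Definition barred (x : letter) : bool := x.1.
Definition unbar (x : letter) : nat := x.2.

(* An unbarred dummy, so that the (meaningless) southwest entry of the empty
   tableau does not count as barred. *)
Definition dflt : letter := (false, 0).

Definition filling := seq (seq letter).

Definition natural_le (x y : letter) : bool :=
  (unbar x < unbar y) || (unbar x == unbar y) && (barred y ==> barred x).

(* The position, from 1, of a letter in the list
   -1 ... -k 1 ... k -(k+1) k+1 -(k+2) k+2 ...   (a minus sign is a bar),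
   so that comparing ranks is comparing letters for the order <^k. *)
Definition rank (k : nat) (x : letter) : nat :=
  if unbar x <= k then (if barred x then unbar x else k + unbar x)
  else (if barred x then (unbar x).*2.-1 else (unbar x).*2).

Definition lek (k : nat) (x y : letter) : bool := rank k x <= rank k y.
Definition ltk (k : nat) (x y : letter) : bool := rank k x < rank k y.

Lemma lek1E (x y : letter) :
  0 < unbar x -> 0 < unbar y -> lek 1 x y = natural_le x y.
Proof.
case: x y => [[] n] [[] m]; rewrite /lek /rank /natural_le /unbar /barred /=;
  case: ifP; case: ifP; lia.
Qed.

Record colored_tableau (le : rel letter) (T : filling) : Prop := {
  ct_straight : straight T;
  ct_alphabet : forall c, in_diagram T c -> 0 < unbar (entry dflt T c);
  ct_row : forall i j1 j2, j1 < j2 -> in_diagram T (i, j2) ->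
    le (entry dflt T (i, j1)) (entry dflt T (i, j2));
  ct_col : forall i1 i2 j, i1 < i2 -> in_diagram T (i2, j) ->
    le (entry dflt T (i1, j)) (entry dflt T (i2, j));
  ct_row_barred : forall i j1 j2, j1 < j2 -> in_diagram T (i, j2) ->
    barred (entry dflt T (i, j2)) ->
    entry dflt T (i, j1) <> entry dflt T (i, j2);
  ct_col_unbarred : forall i1 i2 j, i1 < i2 -> in_diagram T (i2, j) ->
    ~~ barred (entry dflt T (i2, j)) ->
    entry dflt T (i1, j) <> entry dflt T (i2, j)
}.

Definition southwest (T : filling) : letter := entry dflt T ((size T).-1, 0).

Definition C_minus (T : filling) : filling :=
  set_entry dflt T ((size T).-1, 0) (false, unbar (southwest T)).

(* The cell of the <^k-greater of the neighbors above and to the left.  When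
   the two are equal, the one above is the greater after standardization if
   they are unbarred, being further to the right.  Equal barred neighbors need
   no rule: in a conversion, only unbarred letters are exchanged with the
   sliding barred letter. *)
Definition greater_neighbor (k : nat) (T : filling) (c : nat * nat) :
    option (nat * nat) :=
  match c with
  | (0, 0) => None
  | (i.+1, 0) => Some (i, 0)
  | (0, j.+1) => Some (0, j)
  | (i.+1, j.+1) =>
      Some (if lek k (entry dflt T (i.+1, j)) (entry dflt T (i, j.+1))
            then (i, j.+1) else (i.+1, j))
  end.

(* At most n exchanges are made; each decreases i + j by one, so n = i + j is
   enough for the entry of the cell (i, j). *)
Fixpoint slide (k n : nat) (T : filling) (c : nat * nat) : filling :=
  if n is n'.+1 then
    if greater_neighbor k T c is Some d then
      if ltk k (entry dflt T c) (entry dflt T d)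
      then slide k n' (exchange dflt T c d) d
      else T
    else T
  else T.

(* A row of a colored tableau contains a barred letter at most once. *)
Definition occurrences (T : filling) (b : letter) : seq (nat * nat) :=
  [seq (i, index b (nth [::] T i)) | i <- iota 0 (size T) & b \in nth [::] T i].

(* The conversion from <^k to <^(k+1).  The occurrences of the barred letter
   k+1 are taken from top to bottom, that is, in increasing order for the
   standardization for which the columns increase strictly.  This order
   matters: started from the bottom, the slides applied to the tableau with
   rows 1 -2 / -2 (a minus sign is a bar) give -2 -2 / 1, which is not a
   colored tableau.  A slide only changes rows weakly above its starting cell,
   so the occurrences not yet taken stay in place. *)
Definition convk (k : nat) (T : filling) : filling :=
  foldl (fun U c => slide k.+1 (c.1 + c.2) U c) T (occurrences T (true, k.+1)).

Definition max_letter (T : filling) : nat := \max_(x <- flatten T) unbar x.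

Definition conv (T : filling) : filling :=
  foldl (fun U k => convk k U) T (iota 1 (max_letter T)).

(* Rows are kept as lists, so the horizontal position of a row of the skew
   tableau sub_unbarred T is forgotten; its row reading word is not affected. *)
Definition sub_barred (T : filling) : filling :=
  [seq [seq x <- r | barred x] | r <- T].
Definition sub_unbarred (T : filling) : filling :=
  [seq [seq x <- r | ~~ barred x] | r <- T].

Definition remove_bars (T : filling) : seq (seq nat) := map (map unbar) T.

Inductive knuth : seq nat -> seq nat -> Prop :=
| knuth_yzx u v x y z : x < y -> y <= z ->
    knuth (u ++ [:: y; z; x] ++ v) (u ++ [:: y; x; z] ++ v)
| knuth_xzy u v x y z : x <= y -> y < z ->
    knuth (u ++ [:: x; z; y] ++ v) (u ++ [:: z; x; y] ++ v)
| knuth_refl u : knuth u u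
| knuth_sym u v : knuth u v -> knuth v u
| knuth_trans u v w : knuth u v -> knuth v w -> knuth u w.

Record semistandard (P : seq (seq nat)) : Prop := {
  ss_straight : straight P;
  ss_row : forall i j1 j2, j1 < j2 -> in_diagram P (i, j2) ->
    entry 0 P (i, j1) <= entry 0 P (i, j2);
  ss_col : forall i1 i2 j, i1 < i2 -> in_diagram P (i2, j) ->
    entry 0 P (i1, j) < entry 0 P (i2, j)
}.

Definition blft_word (T : filling) : seq nat :=
  let T' := conv T in
  rowword (remove_bars (transpose dflt (sub_barred T'))) ++
  rowword (remove_bars (sub_unbarred T')).

(* "The" semistandard tableau Knuth equivalent to the word above: it exists and
   is unique for every word (Knuth), so epsilon picks it. *)
Definition blft (T : filling) : seq (seq nat) :=
  epsilon (inhabits [::])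
    (fun P => semistandard P /\ knuth (rowword P) (blft_word T)).

(* Main.v *)
(* Standardize a tableau into a chain of Young diagrams, each step of which adds
   a cell with its letter.  Conversion moves the barred letters to the front of
   the chain by local interchanges of a barred letter with the unbarred one next
   to it, and the mirror process moves them to the end.  A local rule which is an
   involution governs all interchanges, so the outcome of either sorting only
   depends on the class of the chain under interchanges.  A complete passage of
   one letter through all those of the other colour is a jeu de taquin slide;
   hence the unbarred entries have Knuth equivalent reading words after the two
   sortings, and so have the barred ones, transposed.

   Let the southwest entry of [T] be a barred [a], and let [z] be the cell below
   it.  Insert into the chain of [C_minus T], right after the southwest [a], a
   barred [a] in the cell [z]; insert likewise an unbarred [a] in [z] into the
   chain of [T].  The two chains obtained differ by one interchange, so they have
   the same conversion.  In the conversion of the second and in the opposite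
   sorting of the first the letter in [z] never moves.  Reading words off, the
   unbarred part for [C_minus T] is equivalent to [a] followed by the one for
   [T], and the barred part for [T] to the one for [C_minus T] followed by [a]:
   both concatenations are equivalent to the same word.

   The reading words of the given tableaux themselves are not invariant under
   the single interchanges, which is why both sortings are needed. *)

Require Import Defs.
From Stdlib Require Import FunctionalExtensionality PropExtensionality.
From Stdlib Require Import ClassicalEpsilon.
From mathcomp Require Import all_boot zify.

Set Implicit Arguments.
Unset Strict Implicit.
Unset Printing Implicit Defensive.

(** * Plactic relations *)

Lemma knuth_ctx a b u v : knuth u v -> knuth (a ++ u ++ b) (a ++ v ++ b).
Proof.
elim=> {u v} [u v x y z xy yz|u v x y z xy yz|u|u v _ /knuth_sym //|u v w _ + _].
- by rewrite -!catA !(catA a); exact: knuth_yzx.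
- by rewrite -!catA !(catA a); exact: knuth_xzy.
- exact: knuth_refl.
- exact: knuth_trans.
Qed.

Lemma knuth_catl a u v : knuth u v -> knuth (a ++ u) (a ++ v).
Proof. by move/(knuth_ctx a [::]); rewrite !cats0. Qed.

Lemma knuth_catr b u v : knuth u v -> knuth (u ++ b) (v ++ b).
Proof. exact: (knuth_ctx [::]). Qed.

(** [r] passes leftwards over the letters of [q], last one first. The letter in front of the one
    being passed is the witness of the relation. *)
Lemma knuth_bump_right p q r :
  r < p -> path leq p q -> knuth (p :: q ++ [:: r]) (p :: r :: q).
Proof.
elim: q p => [|y q IHq] p rp /=; first by move=> _; exact: knuth_refl.
case/andP=> py qP; apply: (@knuth_trans _ (p :: y :: r :: q)).
  by apply: (knuth_catl [:: p]); apply: IHq => //; exact: leq_trans rp py.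
exact: (@knuth_yzx [::] q r p y).
Qed.

(** [p] passes leftwards over the letters of [a]. The witness is the next letter of the row after
    the one being passed; it is at most [r], hence smaller than [p]. *)
Lemma knuth_bump_left a p r :
  sorted leq (rcons a r) -> r < p -> knuth (a ++ [:: p; r]) (p :: rcons a r).
Proof.
move=> + rp; elim: a => [|x a IHa] aP /=; first exact: knuth_refl.
apply: (@knuth_trans _ (x :: p :: rcons a r)).
  by apply: (knuth_catl [:: x]); apply: IHa; exact: path_sorted aP.
case: a aP {IHa} => [|y a] /= /andP[xy aP].
  exact: (@knuth_xzy [::] [::] x r p).
apply: (@knuth_xzy [::] (rcons a r) x y p xy).
by apply: leq_ltn_trans rp; move: aP; rewrite (path_sortedE leq_trans)
  all_rcons => /andP[/andP[]].
Qed.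

(** Schensted row insertion: the letters of [r], inserted in turn into the row [a p q], bump out
    those of [p]. *)
Lemma knuth_bump a p q r :
  sorted leq (a ++ p ++ q) -> sorted leq (a ++ r) -> all2 ltn r p ->
  knuth (a ++ p ++ q ++ r) (p ++ a ++ r ++ q).
Proof.
elim: p a r => [|x p IHp] a [|y r] //=.
  by rewrite !cats0 => *; exact: knuth_refl.
move=> apq ar /andP[yx rp].
have /= pqP : sorted leq (x :: p ++ q) by move/cat_sorted2: apq => [].
apply: (@knuth_trans _ (a ++ (x :: y :: p ++ q) ++ r)).
  have -> : x :: p ++ q ++ y :: r = (x :: (p ++ q) ++ [:: y]) ++ r.
    by rewrite /= -!catA.
  by apply: knuth_ctx; exact: knuth_bump_right.
apply: (@knuth_trans _ ((x :: rcons a y) ++ (p ++ q ++ r))).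
  have -> : a ++ (x :: y :: p ++ q) ++ r = (a ++ [:: x; y]) ++ p ++ q ++ r.
    by rewrite /= -!catA.
  apply: knuth_catr; apply: knuth_bump_left => //.
  by move: ar; rewrite -cat_rcons => /cat_sorted2[].
apply: (knuth_catl [:: x]).
have -> : p ++ a ++ y :: r ++ q = p ++ rcons a y ++ r ++ q by rewrite cat_rcons.
apply: IHp => //; rewrite ?cat_rcons //.
have pw := sorted_pairwise leq_trans.
rewrite pw pairwise_cat pairwise_cons allrel_consr.
move: apq; rewrite pw pairwise_cat pairwise_cons allrel_consr.
move=> /and3P[/andP[_ ->] -> /andP[xpq ->]].
move: ar; rewrite pw pairwise_cat allrel_consr => /andP[/andP[-> _] _].
by rewrite !andbT /=; apply: sub_all xpq => t /=; lia.
Qed.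

(* A vertical jeu de taquin move: [x] leaves the upper row [r x s1 s2] for the
   gap of the lower row [p0 p1 _ q]. *)
Lemma knuth_vertical_move p0 p1 q r x s1 s2 :
  sorted leq (p1 ++ x :: q) -> sorted leq r -> sorted leq (x :: s1) ->
  all2 ltn r p1 -> all2 ltn s1 q ->
  knuth ((p0 ++ p1 ++ q) ++ r ++ x :: s1 ++ s2)
        ((p0 ++ p1 ++ x :: q) ++ r ++ s1 ++ s2).
Proof.
move=> pxq rP xs rp sq.
have pq : sorted leq (p1 ++ q).
  by apply: subseq_sorted pxq; [exact: leq_trans|
     rewrite cat_subseq // subseq_cons].
have xqP : sorted leq (x :: q) by move/cat_sorted2: pxq => [].
rewrite -!catA; apply: knuth_catl.
(* On both sides [r] bumps [p1]. It remains to compare [q x s1] with [x q s1], where [s1] bumps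
   [q]. *)
have H t u : sorted leq (p1 ++ t) ->
  knuth (p1 ++ t ++ r ++ u) (p1 ++ r ++ t ++ u).
  move=> tP.
  have := @knuth_bump [::] p1 t r tP rP rp.
  by move/(knuth_catr u); rewrite /= -!catA.
apply: (knuth_trans (H _ _ pq)).
apply: knuth_sym; apply: (knuth_trans (H (x :: q) _ pxq)).
do 2!apply: knuth_catl.
have := @knuth_bump [:: x] q [::] s1; rewrite !cats0 => /(_ xqP xs sq).
by move/(knuth_catr s2); rewrite /= -!catA.
Qed.

(** * Chains of cells *)

(* A tableau is represented by the list of its (cell, letter) pairs in the
   standardized order of the letters, so that the prefixes of the list fill a
   chain of Young diagrams. *)
Notation cell := (nat * nat)%type.
Notation elt := (cell * letter)%type.

Definition lec (c d : cell) : bool := (c.1 <= d.1) && (c.2 <= d.2).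

Definition adj (c d : cell) : bool :=
  (c.1 == d.1) && ((c.2 == d.2.+1) || (d.2 == c.2.+1)) ||
  (c.2 == d.2) && ((c.1 == d.1.+1) || (d.1 == c.1.+1)).

Lemma adjC c d : adj c d = adj d c.
Proof.
by rewrite /adj (eq_sym c.1 d.1) (eq_sym c.2 d.2)
  (orbC (c.2 == _)) (orbC (c.1 == _.+1)).
Qed.

Definition down (D : seq cell) : Prop :=
  forall c d, lec c d -> d \in D -> c \in D.

Definition addable (D : seq cell) (c : cell) : Prop :=
  c \notin D /\ forall d, lec d c -> d != c -> d \in D.

Fixpoint valid (D s : seq cell) : Prop :=
  if s is c :: s' then addable D c /\ valid (rcons D c) s' else True.

Lemma addable_eq D D' c : D =i D' -> addable D c -> addable D' c.
Proof.
by move=> e [cD h]; split=> [|d /h{}h /h]; rewrite -e.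
Qed.

Lemma valid_eq D D' s : D =i D' -> valid D s -> valid D' s.
Proof.
elim: s D D' => //= c s IHs D D' e [/(addable_eq e) cD sV]; split=> //.
by apply: IHs sV => d; rewrite !mem_rcons !inE e.
Qed.

Lemma valid_cat D s1 s2 : valid D (s1 ++ s2) <-> valid D s1 /\ valid (D ++ s1) s2.
Proof.
elim: s1 D => [|c s IHs] D /=; first by rewrite cats0; tauto.
by rewrite -cat_rcons; have := IHs (rcons D c); tauto.
Qed.

Lemma valid_notin D s c : valid D s -> c \in s -> c \notin D.
Proof.
elim: s D => //= d s IHs D [[dD _] sV]; rewrite inE => /predU1P[-> //|].
by move/(IHs _ sV); rewrite mem_rcons inE negb_or => /andP[].
Qed.

Lemma valid_uniq D s : valid D s -> uniq s.
Proof.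
elim: s D => //= d s IHs D [_ sV]; rewrite (IHs _ sV) andbT.
by apply/negP=> /(valid_notin sV); rewrite mem_rcons inE eqxx.
Qed.

Lemma down_addable D c : down D -> addable D c -> down (rcons D c).
Proof.
move=> dD [cD h] x y xy; rewrite !mem_rcons !inE => /predU1P[e|/(dD _ _ xy)->].
  by have [//|xc] := eqVneq x c; apply: h; rewrite // -e.
by rewrite orbT.
Qed.

Lemma down_valid D s : down D -> valid D s -> down (D ++ s).
Proof.
elim: s D => [|c s IHs] D dD /=; first by rewrite cats0.
by case=> cD sV; rewrite -cat_rcons; apply: IHs => //; exact: down_addable.
Qed.

Lemma down_nil : down [::].
Proof. by []. Qed.

Lemma nonadj_between (c d : cell) : lec c d -> c != d -> ~~ adj c d ->
  exists e, [/\ lec c e, lec e d, e != c & e != d].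
Proof.
case: c d => [a a'] [b b'] h n na.
move: h n na; rewrite /lec /adj !xpair_eqE /= => /andP[h1 h2] n na.
case: (ltnP a b) => ab.
  by exists (a.+1, a'); rewrite !xpair_eqE /=; split; lia.
by exists (a, a'.+1); rewrite !xpair_eqE /=; split; lia.
Qed.

(** Were [c] needed for adding [d], some third cell would lie between the two. It would belong to
    [D], and then so would [c]. *)
Lemma addable_swap D c d : down D -> addable D c -> addable (rcons D c) d ->
  ~~ adj c d -> addable D d /\ addable (rcons D d) c.
Proof.
move=> dD [cD hc] [dcD hd] na.
move: dcD; rewrite mem_rcons inE negb_or => /andP[dc dND].
split; split=> //.
- move=> x xd xnd; move: (hd x xd xnd); rewrite mem_rcons inE.
  case/predU1P=> // e; rewrite {x}e in xd xnd *.
  have [y [cy yd yc ynd]] := nonadj_between xd xnd na.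
  by move: (hd y yd ynd); rewrite mem_rcons inE (negPf yc) /= => /(dD _ _ cy).
- by rewrite mem_rcons inE negb_or eq_sym dc.
- by move=> x xc xn; rewrite mem_rcons inE hc ?orbT.
Qed.

Lemma valid_swap D c d s : down D -> ~~ adj c d ->
  valid D (c :: d :: s) -> valid D (d :: c :: s).
Proof.
move=> dD na /= [cD [dD' sV]].
have [? ?] := addable_swap dD cD dD' na; do 2!split=> //.
by apply: valid_eq sV => x; rewrite !mem_rcons !inE !mem_rcons !inE orbCA.
Qed.

(** A chain is a linear extension of the order of cells, so numbering the cells by position gives a
    standard filling. *)
Lemma valid_index D s c d : valid D s -> c \in s -> d \in s -> lec d c ->
  index d s <= index c s.
Proof.
elim: s D => //= x s IHs D [[xD h] sV]; rewrite !inE.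
have [->|xd] := eqVneq x d; first by [].
case/predU1P=> [->|cs] /= ds dc.
  by have := valid_notin sV ds; rewrite mem_rcons inE h ?orbT // eq_sym.
have xc : x != c.
  by apply: contraTneq cs => <-; apply/negP=> /(valid_notin sV);
     rewrite mem_rcons inE eqxx.
by rewrite (negPf xc); exact: IHs sV cs ds dc.
Qed.

(** * Jeu de taquin moves and the reading word *)

(** Column intervals allow a row to be cut into pieces around a hole. *)
Definition seg (s : seq cell) i a m : seq nat :=
  [seq index (i, j) s | j <- iota a m & (i, j) \in s].

(* The reading word of the standard filling of the cells of [s], each labelled
   by its position in [s]; [n] bounds the coordinates. *)
Definition cword n (s : seq cell) : seq nat :=
  flatten [seq seg s i 0 n | i <- rev (iota 0 n)].

Lemma seg_add s i a m p : seg s i a (m + p) = seg s i a m ++ seg s i (a + m) p.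
Proof. by rewrite /seg iotaD filter_cat map_cat. Qed.

Lemma eq_seg s s' i a m :
  (forall j, a <= j < a + m -> ((i, j) \in s) = ((i, j) \in s')) ->
  (forall j, a <= j < a + m -> (i, j) \in s -> index (i, j) s = index (i, j) s') ->
  seg s i a m = seg s' i a m.
Proof.
move=> e1 e2; rewrite /seg.
have -> : [seq j <- iota a m | (i, j) \in s'] = [seq j <- iota a m | (i, j) \in s].
  by apply: eq_in_filter => j; rewrite mem_iota => /e1.
by apply/eq_in_map => j; rewrite mem_filter mem_iota => /andP[js /e2->].
Qed.

Lemma seg_nil s i a m :
  (forall j, a <= j < a + m -> (i, j) \notin s) -> seg s i a m = [::].
Proof.
move=> h; rewrite /seg (eq_in_filter (a2 := pred0)) ?filter_pred0 // => j.
by rewrite mem_iota => /h/negPf.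
Qed.

Lemma seg_full s i a m : (forall j, a <= j < a + m -> (i, j) \in s) ->
  seg s i a m = [seq index (i, j) s | j <- iota a m].
Proof.
move=> h; rewrite /seg (eq_in_filter (a2 := predT)) ?filter_predT // => j.
by rewrite mem_iota => /h.
Qed.

Lemma seg_sorted s i a m :
  (forall j k, j < k -> (i, j) \in s -> (i, k) \in s ->
     index (i, j) s <= index (i, k) s) ->
  sorted leq (seg s i a m).
Proof.
move=> h; rewrite /seg sorted_map.
rewrite (sorted_pairwise_in (P := mem [seq j <- iota a m | (i, j) \in s])).
- apply: (sub_in_pairwise (P := mem [seq j <- iota a m | (i, j) \in s]) (r := ltn)).
  + move=> j k; rewrite !mem_filter => /andP[js _] /andP[ks _] jk.
    exact: h.
  + exact/allP.
  + by rewrite -(sorted_pairwise ltn_trans) (sorted_filter ltn_trans) // iota_ltn_sorted.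
- by move=> x y z _ _ _ /=; exact: leq_trans.
- exact/allP.
Qed.

(** Finds where a row leaves a Young diagram. *)
Lemma antitone_threshold (a : pred nat) p :
  (forall t t', t <= t' -> a t' -> a t) ->
  exists2 m, m <= p & forall t, t < p -> a t = (t < m).
Proof.
move=> anti; elim: p => [|p [m mp h]]; first by exists 0.
case ap: (a p).
  by exists p.+1 => // t; rewrite ltnS => tp; rewrite (anti _ _ tp ap) tp.
exists m => [|t]; first exact: leqW.
rewrite ltnS leq_eqVlt => /predU1P[->|/h//].
by rewrite ap ltnNge mp.
Qed.

Lemma cword_rows n s i : i.+1 < n -> cword n s =
  flatten [seq seg s k 0 n | k <- rev (iota i.+2 (n - i.+2))] ++
  seg s i.+1 0 n ++ seg s i 0 n ++ flatten [seq seg s k 0 n | k <- rev (iota 0 i)].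
Proof.
move=> bi; rewrite /cword; 
have -> : iota 0 n = iota 0 i ++ [:: i, i.+1 & iota i.+2 (n - i.+2)].
  by rewrite -{1}(subnKC bi) -{1}(addn2 i) -addnA iotaD.
rewrite rev_cat !rev_cons map_cat !map_rcons flatten_cat -!cats1 !flatten_cat /=.
by rewrite !cats0 -!catA.
Qed.

Lemma all2_map_iota (r : rel nat) f g a m :
  (forall t, a <= t < a + m -> r (f t) (g t)) ->
  all2 r [seq f t | t <- iota a m] [seq g t | t <- iota a m].
Proof.
elim: m a => //= m IHm a h; rewrite h /=; last by lia.
by apply: IHm => t tb; apply: h; lia.
Qed.

(** * One jeu de taquin move into a hole *)

Section HoleMove.
Variables (D U0 U1 : seq cell) (u h : cell).
(** In [A] the cell [h] is the hole; in [A'] the label [size U0] has moved from [u] to [h], which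
    leaves [u] as the hole. All other labels agree. [D] is the inner shape. *)
Local Notation s := (U0 ++ u :: h :: U1).
Local Notation A := (U0 ++ u :: U1).
Local Notation A' := (U0 ++ h :: U1).
Hypotheses (dD : down D) (sV : valid D s).

Local Lemma sU : uniq s. Proof. exact: valid_uniq sV. Qed.

Local Lemma uh_notin : [/\ u != h, u \notin U0, h \notin U0, u \notin U1 & h \notin U1].
Proof.
move: sU; rewrite cat_uniq /= !inE !negb_or.
by case/and4P=> _ /and3P[-> -> _] /andP[-> ->] /andP[->].
Qed.

Local Lemma uh : u != h. Proof. by case: uh_notin. Qed.
Local Lemma hu : h != u. Proof. by rewrite eq_sym uh. Qed.
Local Lemma uU0 : u \notin U0. Proof. by case: uh_notin. Qed.
Local Lemma hU0 : h \notin U0. Proof. by case: uh_notin. Qed.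
Local Lemma uU1 : u \notin U1. Proof. by case: uh_notin. Qed.
Local Lemma hU1 : h \notin U1. Proof. by case: uh_notin. Qed.

Lemma mem_hole_move c : c != u -> c != h -> (c \in A) = (c \in A').
Proof. by move=> cu ch; rewrite !mem_cat !inE (negPf cu) (negPf ch). Qed.

Lemma index_hole_move c : c != u -> c != h -> index c A = index c A'.
Proof.
move=> cu ch; rewrite !index_cat /=.
by rewrite eq_sym (negPf cu) [h == c]eq_sym (negPf ch).
Qed.

Local Lemma index_u : index u A = size U0.
Proof. by rewrite index_cat (negPf uU0) /= eqxx addn0. Qed.

Local Lemma index_h : index h A' = size U0.
Proof. by rewrite index_cat (negPf hU0) /= eqxx addn0. Qed.

Local Lemma notin_A : h \notin A.
Proof. by rewrite mem_cat inE (negPf hU0) (negPf hU1) eq_sym (negPf uh). Qed.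

Local Lemma notin_A' : u \notin A'.
Proof. by rewrite mem_cat inE (negPf uU0) (negPf uU1) (negPf uh). Qed.

Local Lemma memA c : (c \in A) = (c != h) && (c \in s).
Proof.
have [->|ch] := eqVneq c h; first by rewrite (negPf notin_A).
by rewrite !mem_cat !inE (negPf ch).
Qed.

Local Lemma memA' c : (c \in A') = (c != u) && (c \in s).
Proof.
have [->|cu] := eqVneq c u; first by rewrite (negPf notin_A').
by rewrite !mem_cat !inE (negPf cu).
Qed.

Local Lemma index_A c d : c \in A -> d \in A ->
  index c s <= index d s -> index c A <= index d A.
Proof.
(* Deleting [h] lowers by one exactly the positions behind that of [u]. *)
have sA e : e \in A ->
    index e s = if index e A <= size U0 then index e A else (index e A).+1.
  rewrite memA => /andP[eh _]; rewrite !index_cat /=.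
  case: ifP => [/= |_]; first by rewrite -index_mem => /ltnW->.
  rewrite [h == e]eq_sym (negPf eh); case: ifP => _; first by rewrite addn0 leqnn.
  by rewrite ifN ?addnS // -leqNgt leq_addr.
by move=> /sA-> /sA->; case: ifP; case: ifP; clear; lia.
Qed.

Local Lemma index_A' c d : c \in A' -> d \in A' ->
  index c s <= index d s -> index c A' <= index d A'.
Proof.
have sA e : e \in A' ->
    index e s = if index e A' < size U0 then index e A' else (index e A').+1.
  rewrite memA' => /andP[eu _]; rewrite !index_cat /=.
  case: ifP => [/= |_]; first by rewrite -index_mem => ->.
  rewrite [u == e]eq_sym (negPf eu).
  by rewrite (ltnNge _ (size U0)) leq_addr addnS.
by move=> /sA-> /sA->; case: ifP; case: ifP; clear; lia.
Qed.

Local Lemma lec_A c d : c \in A -> d \in A -> lec c d -> index c A <= index d A.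
Proof.
move=> cA dA cd; apply: index_A => //; apply: (valid_index sV) => //.
- by move: dA; rewrite memA => /andP[].
- by move: cA; rewrite memA => /andP[].
Qed.

Local Lemma lec_A' c d : c \in A' -> d \in A' -> lec c d -> index c A' <= index d A'.
Proof.
move=> cA dA cd; apply: index_A' => //; apply: (valid_index sV) => //.
- by move: dA; rewrite memA' => /andP[].
- by move: cA; rewrite memA' => /andP[].
Qed.

Local Lemma rowA i a m : sorted leq (seg A i a m).
Proof. by apply: seg_sorted => j k jk *; apply: lec_A; rewrite // /lec /= leqnn ltnW. Qed.

Local Lemma rowA' i a m : sorted leq (seg A' i a m).
Proof. by apply: seg_sorted => j k jk *; apply: lec_A'; rewrite // /lec /= leqnn ltnW. Qed.

Local Lemma index_inj c d : c \in A -> d \in A -> lec c d -> c != d ->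
  index c A < index d A.
Proof.
move=> cA dA cd ncd; rewrite ltn_neqAle lec_A // andbT.
by apply: contra ncd => /eqP e; rewrite -(nth_index c cA) e nth_index.
Qed.

Local Lemma seg_same i a m :
  (forall j, a <= j < a + m -> (i, j) != u /\ (i, j) != h) ->
  seg A i a m = seg A' i a m.
Proof.
move=> e; apply: eq_seg => j /e[ju jh]; first exact: mem_hole_move.
by move=> _; exact: index_hole_move.
Qed.

Local Lemma us : u \in s. Proof. by rewrite mem_cat !inE eqxx orbT. Qed.
Local Lemma hs : h \in s. Proof. by rewrite mem_cat !inE eqxx !orbT. Qed.

(** The label moves to the next column of its own row, where no other label is passed. *)
Lemma cword_move_right n : h = (u.1, u.2.+1) -> u.2.+1 < n ->
  cword n A = cword n A'.
Proof.
move=> eh bn; congr flatten; apply/eq_map => i.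
have [->|iu] := eqVneq i u.1; last first.
  by apply: seg_same => j _; rewrite eh; split; apply: contra iu => /eqP; [move<- | case=> ->].
rewrite (_ : n = u.2 + (2 + (n - u.2.+2))); last by lia.
rewrite !seg_add; congr (_ ++ (_ ++ _)).
- by apply: seg_same => j jb; rewrite eh; case: (u) jb => x y /=;
     rewrite !xpair_eqE; lia.
- have eu : (u.1, u.2) = u by case: (u).
  rewrite /seg add0n /= -eh eu (negPf notin_A) (negPf notin_A').
  by rewrite memA memA' us hs uh hu /= -eh eu index_u index_h.
- by apply: seg_same => j jb; rewrite eh; case: (u) jb => x y /=;
     rewrite !xpair_eqE; lia.
Qed.

Local Lemma before_u c : lec c u -> c != u -> c \in D \/ c \in U0.
Proof.
have : valid D (U0 ++ u :: h :: U1) by exact: sV.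
case/valid_cat=> _ [[_ H] _] cu ncu.
by move: (H c cu ncu); rewrite mem_cat => /orP.
Qed.

Local Lemma before_h c : lec c h -> c != h -> c != u -> c \in D \/ c \in U0.
Proof.
have : valid D (U0 ++ u :: h :: U1) by exact: sV.
case/valid_cat=> _ [_ [[_ H] _]] cu nch ncu.
by move: (H c cu nch); rewrite mem_rcons inE (negPf ncu) /= mem_cat => /orP.
Qed.

Local Lemma notinD c : c \in s -> c \notin D. Proof. exact: valid_notin sV. Qed.

Local Lemma downDs : down (D ++ s). Proof. exact: down_valid. Qed.

Local Lemma in_Ds c : c \in s -> c \in D ++ s.
Proof. by move=> cs; rewrite mem_cat cs orbT. Qed.

(** Only the rows of [u] and [h] change. They are cut at the columns [m], [j] and [j + 1 + p] into
    the pieces required by [knuth_vertical_move]. *)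
Lemma knuth_move_down n : h = (u.1.+1, u.2) -> u.1.+1 < n -> u.2 < n ->
  knuth (cword n A) (cword n A').
Proof.
have [i [j eu]] : exists i j, u = (i, j) by exists u.1, u.2; case: (u).
rewrite eu /= -eu => eh bi bj.
have other k a m : k != i -> k != i.+1 -> seg A k a m = seg A' k a m.
  by move=> ki kSi; apply: seg_same => l _; rewrite eh eu !xpair_eqE; lia.
have rows r : (forall k, k \in r -> k != i /\ k != i.+1) ->
    [seq seg A k 0 n | k <- r] = [seq seg A' k 0 n | k <- r].
  by move=> hr; apply/eq_in_map => k /hr[? ?]; exact: other.
rewrite !(cword_rows _ bi) !rows; try
  by move=> k; rewrite mem_rev mem_iota; lia.
apply: knuth_catl; rewrite !catA; apply: knuth_catr.
(* The inner shape occupies the first [m] columns of the upper row. *)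
have [m mj mD] : exists2 m, m <= j & forall t, t < j -> ((i, t) \in D) = (t < m).
  by apply: antitone_threshold => t t' tt'; apply: dD; rewrite /lec /=; lia.
pose e := n - j.+1.
(* [p] cells follow the hole [h] in the lower row; the cells above them are filled too. *)
have [p pe pP] : exists2 p, p <= e &
    forall t, t < e -> ((i.+1, j.+1 + t) \in s) = (t < p).
  apply: antitone_threshold => t t' tt' ts.
  have : (i.+1, j.+1 + t) \in D ++ s.
    by apply: downDs (in_Ds ts); rewrite /lec /=; lia.
  rewrite mem_cat => /orP[tD|//].
  by have := notinD hs; rewrite (dD _ tD) // /lec eh /=; lia.
(* If this cell were in [D], so would be the one above it, which lies beyond column [m]. *)
have in_lo t : m <= t < j -> (i.+1, t) \in U0.
  move=> /andP[mt tj].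
  have /before_h[||tD|//] : lec (i.+1, t) h by rewrite eh /lec /=; lia.
  - by rewrite eh xpair_eqE; lia.
  - by rewrite eu xpair_eqE; lia.
  by have := mD t tj; rewrite (dD _ tD) /lec /=; lia.
have in_up t : m <= t < j -> (i, t) \in U0.
  move=> /andP[mt tj].
  have /before_u[|tD|//] : lec (i, t) u by rewrite eu /lec /=; lia.
  - by rewrite eu xpair_eqE; lia.
  by have := mD t tj; rewrite tD; lia.
have in_up' t : t < p -> (i, j.+1 + t) \in s.
  move=> tp; have ts : (i.+1, j.+1 + t) \in s by rewrite pP ?tp //; lia.
  have : (i, j.+1 + t) \in D ++ s.
    by apply: downDs (in_Ds ts); rewrite /lec /=; lia.
  rewrite mem_cat => /orP[tD|//].
  by have := notinD us; rewrite (dD _ tD) // /lec eu /=; lia.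
have U0A c : c \in U0 -> c \in A by rewrite mem_cat => ->.
have ne x : (i, x) != h by rewrite eh xpair_eqE; lia.
have ne' x : (i.+1, x) != u by rewrite eu xpair_eqE; lia.
have split r : r = m + ((j - m) + (1 + (p + (e - p)))) -> r = n.
  by rewrite /e; lia.
rewrite -(split _ erefl) !seg_add !add0n subnKC //.
have eqA k a l : (k == i) && (a + l <= j) || (k == i.+1) && (a + l <= j) || (j < a) ->
    seg A' k a l = seg A k a l.
  move=> hk; symmetry; apply: seg_same => t tb; rewrite eh eu !xpair_eqE.
  by split; move: hk tb; lia.
rewrite !(eqA _ 0) ?(eqA _ m) ?(eqA _ (j + 1)) ?(eqA _ (j + 1 + p)); try lia.
have -> : seg A i.+1 j 1 = [::].
  by rewrite /seg /= -eh (negPf notin_A).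
have -> : seg A' i j 1 = [::].
  by rewrite /seg /= -eu (negPf notin_A').
have seg_h : seg A' i.+1 j 1 = [:: size U0].
  by rewrite /seg /= -eh memA' hu hs /= -eh index_h.
have seg_u : seg A i j 1 = [:: size U0].
  by rewrite /seg /= -eu memA uh us /= -eu index_u.
have -> : seg A i 0 m = [::].
  apply: seg_nil => t; rewrite add0n => /andP[_ tm]; rewrite memA ne /=.
  by apply/negP=> /notinD; rewrite mD ?tm // (leq_trans tm).
have -> : seg A i.+1 (j + 1 + p) (e - p) = [::].
  apply: seg_nil => t tb; rewrite memA; apply/nandP; right.
  have -> : t = j.+1 + (t - j.+1) by lia.
  by rewrite pP; lia.
rewrite seg_h seg_u /= !cats0 -!catA.
have all_lo : all2 ltn (seg A i m (j - m)) (seg A i.+1 m (j - m)).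
  rewrite !seg_full; try by move=> t tb; apply: U0A; rewrite ?in_lo ?in_up //; lia.
  apply: all2_map_iota => t tb; apply: index_inj.
  - by apply/U0A/in_up; lia.
  - by apply/U0A/in_lo; lia.
  - by rewrite /lec /=; lia.
  - by rewrite xpair_eqE; lia.
have all_up : all2 ltn (seg A i (j + 1) p) (seg A i.+1 (j + 1) p).
  have full t : j + 1 <= t < j + 1 + p -> (i, t) \in A /\ (i.+1, t) \in A.
    move=> tb; have -> : t = j.+1 + (t - j.+1) by lia.
    rewrite !memA ne in_up' ?pP //=; try lia.
    by rewrite eh xpair_eqE; split=> //; lia.
  rewrite !seg_full; try by move=> t /full[].
  apply: all2_map_iota => t /full[? ?]; apply: index_inj => //.
  - by rewrite /lec /=; lia.
  - by rewrite xpair_eqE; lia.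
have srt : sorted leq (seg A i.+1 m (j - m) ++ size U0 :: seg A i.+1 (j + 1) p).
  have := rowA' i.+1 m ((j - m) + (1 + p)); rewrite !seg_add subnKC //.
  rewrite (eqA _ m) ?(eqA _ (j + 1)); try lia.
  by rewrite seg_h.
have srt' : sorted leq (size U0 :: seg A i (j + 1) p).
  have := rowA i j (1 + p); rewrite !seg_add.
  by rewrite seg_u.
have := knuth_vertical_move (seg A i.+1 0 m) (seg A i (j + 1 + p) (e - p))
  srt (rowA _ _ _) srt' all_lo all_up.
by rewrite /= -!catA.
Qed.
End HoleMove.

(* The local rule for chains of Young diagrams, on two consecutive elements [p]
   and [q]: adjacent cells keep their order and exchange their letters, other
   cells move with their letters. *)
Definition swp (p q : elt) : elt * elt :=
  if adj p.1 q.1 then ((p.1, q.2), (q.1, p.2)) else (q, p).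

Lemma swpK p q : swp (swp p q).1 (swp p q).2 = (p, q).
Proof.
rewrite /swp; case h: (adj p.1 q.1) => /=; last by rewrite adjC h.
by rewrite h; case: p q {h} => ? ? [? ?].
Qed.

Lemma swp_letter p q : ((swp p q).1.2 = q.2) * ((swp p q).2.2 = p.2).
Proof. by rewrite /swp; case: ifP. Qed.

Lemma swp_valid D p q s : down D -> valid D [:: p.1, q.1 & s] ->
  valid D [:: (swp p q).1.1, (swp p q).2.1 & s].
Proof. by rewrite /swp; case: ifP => // h dD; apply: valid_swap; rewrite ?h. Qed.

(** * Passing one element through a chain *)

Definition cells (s : seq elt) : seq cell := [seq e.1 | e <- s].
Definition letters (s : seq elt) : seq letter := [seq e.2 | e <- s].

(** [b] stands behind [s] and meets the last element of [s] first. The first component of the result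
    is [b] on its arrival in front. *)
Fixpoint push (s : seq elt) (b : elt) : elt * seq elt :=
  if s is u :: s' then
    let: (b', s1) := push s' b in ((swp u b').1, (swp u b').2 :: s1)
  else (b, [::]).

Lemma push_cons u s b : push (u :: s) b =
  ((swp u (push s b).1).1, (swp u (push s b).1).2 :: (push s b).2).
Proof. by rewrite /=; case: push. Qed.

Lemma push_cat s1 s2 b : push (s1 ++ s2) b =
  ((push s1 (push s2 b).1).1, (push s1 (push s2 b).1).2 ++ (push s2 b).2).
Proof.
elim: s1 => [|u s1 IHs]; first by case: push.
by rewrite cat_cons !push_cons IHs.
Qed.

Lemma push_rcons s u b : push (rcons s u) b =
  ((push s (swp u b).1).1, rcons (push s (swp u b).1).2 (swp u b).2).
Proof. by rewrite -cats1 push_cat -cats1. Qed.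

Lemma push_letter s b : (push s b).1.2 = b.2.
Proof. by elim: s => // u s IHs; rewrite push_cons /= swp_letter. Qed.

Lemma push_letters s b : letters (push s b).2 = letters s.
Proof.
by elim: s => // u s IHs; rewrite push_cons /= IHs swp_letter.
Qed.

Lemma push_valid D s b t : down D -> valid D (cells s ++ b.1 :: t) ->
  valid D ((push s b).1.1 :: cells (push s b).2 ++ t).
Proof.
elim: s D => // u s IHs D dD; rewrite push_cons cat_cons => -[uD sV].
apply: swp_valid => //; split=> //; apply: IHs sV; exact: down_addable.
Qed.

Lemma mem_push s b : cells (rcons s b) =i (push s b).1.1 :: cells (push s b).2.
Proof.
elim: s => // u s IHs c; rewrite push_cons /= inE IHs !inE /swp.
by case: ifP => //= _; rewrite orbCA.
Qed.

(* [s ++ b :: t] is the chain while [b] is on its way through [s ++ t]. *)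
Lemma push_knuth D n s b t : down D -> valid D (cells s ++ b.1 :: cells t) ->
  all (fun c => (c.1 < n) && (c.2 < n)) (b.1 :: cells s) ->
  knuth (cword n (cells (s ++ t))) (cword n (cells ((push s b).2 ++ t))).
Proof.
elim/last_ind: s b t => [|s u IHs] b t dD; first by move=> *; exact: knuth_refl.
rewrite push_rcons !cat_rcons /cells map_rcons cat_rcons -/cells => sV bn.
have [/= bn0 [un sn]] : (b.1.1 < n) && (b.1.2 < n) /\
    (u.1.1 < n) && (u.1.2 < n) /\ all (fun c => (c.1 < n) && (c.2 < n)) (cells s).
  by move: bn; rewrite /= all_rcons => /and3P[].
have bn' : all (fun c => (c.1 < n) && (c.2 < n)) ((swp u b).1.1 :: cells s).
  by rewrite /= sn andbT /swp; case: ifP.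
have [s1 s2] := (valid_cat _ _ _).1 sV.
have sV' : valid D (cells s ++ (swp u b).1.1 :: cells ((swp u b).2 :: t)).
  by apply/valid_cat; split=> //; apply: swp_valid s2; exact: down_valid.
apply: knuth_trans (IHs _ _ dD sV' bn').
rewrite /cells !map_cat /= -/(cells _) -/(cells _) /swp.
case: ifP => [ub|_] /=; last exact: knuth_refl.
(* As [u] enters the chain before [b], adjacency leaves only two cases: [b] is to the right of [u]
   or below it. *)
have lt_ub : ~~ lec b.1 u.1.
  apply/negP=> bu; case: s2 => [[_ hu] [[]]]; rewrite mem_rcons inE negb_or.
  by case/andP=> bNu + _ _; rewrite hu.
have := lt_ub; have := ub; rewrite /adj /lec.
case: (altP (u.1.1 =P b.1.1)) => /= [e _ _|_ ub' lt_ub'].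
  have e2 : b.1 = (u.1.1, u.1.2.+1).
    by rewrite {1}[b.1]surjective_pairing; congr (_, _); move: ub lt_ub; rewrite /adj /lec; lia.
  rewrite (cword_move_right sV e2); first exact: knuth_refl.
  by move: bn0; rewrite e2 => /andP[].
have e2 : b.1 = (u.1.1.+1, u.1.2).
  by rewrite {1}[b.1]surjective_pairing; congr (_, _); move: ub' lt_ub'; lia.
apply: (knuth_move_down dD sV e2); last by case/andP: un.
by move: bn0; rewrite e2 => /andP[].
Qed.

(** * Sorting the bars first *)

(** The state is the sorted form of the elements read so far: the barred ones, then the unbarred
    ones. *)
Definition step (st : seq elt * seq elt) (e : elt) : seq elt * seq elt :=
  if barred e.2 then (rcons st.1 (push st.2 e).1, (push st.2 e).2)
  else (st.1, rcons st.2 e).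

Definition bars_first (s : seq elt) : seq elt * seq elt :=
  foldl step ([::], [::]) s.

(* Transposing the diagram and exchanging the two colours turns the sorting
   which moves bars first into the one which moves bars last. *)
Definition flip (e : elt) : elt := ((e.1.2, e.1.1), (~~ e.2.1, e.2.2)).

Definition flips (s : seq elt) : seq elt := map flip s.

Lemma flipK : involutive flip.
Proof. by case=> [[i j] [b a]]; rewrite /flip /= negbK. Qed.

Lemma flipsK : involutive flips.
Proof. by move=> s; rewrite /flips (mapK flipK). Qed.

Lemma flips_cat s t : flips (s ++ t) = flips s ++ flips t.
Proof. exact: map_cat. Qed.

Lemma barred_flip e : barred (flip e).2 = ~~ barred e.2.
Proof. by []. Qed.

Lemma flip_swp p q : swp (flip p) (flip q) = (flip (swp p q).1, flip (swp p q).2).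
Proof.
rewrite /swp; have -> : adj (flip p).1 (flip q).1 = adj p.1 q.1 by rewrite /adj /= orbC.
by case: ifP.
Qed.

(** When [b] is read, [u] is the last unbarred element, so this very interchange is the first one
    that the sorting makes. *)
Lemma bars_first_swp s1 u b s2 : ~~ barred u.2 -> barred b.2 ->
  bars_first (s1 ++ [:: u, b & s2]) =
  bars_first (s1 ++ [:: (swp u b).1, (swp u b).2 & s2]).
Proof.
move=> hu hb; rewrite /bars_first !foldl_cat /=; congr (foldl step _ s2).
by rewrite /step !swp_letter hb (negPf hu) /= push_rcons.
Qed.

(** Since the local rule is an involution, the opposite sorting undoes the interchange and
    [bars_first_swp] applies from the other side. *)
Lemma bars_first_swp_flip s1 u b s2 : ~~ barred u.2 -> barred b.2 ->
  bars_first (flips (s1 ++ [:: u, b & s2])) =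
  bars_first (flips (s1 ++ [:: (swp u b).1, (swp u b).2 & s2])).
Proof.
move=> hu hb; rewrite !flips_cat /=.
set p := swp u b; have -> : flip u = (swp (flip p.1) (flip p.2)).1.
  by rewrite flip_swp /p swpK.
have -> : flip b = (swp (flip p.1) (flip p.2)).2 by rewrite flip_swp /p swpK.
by rewrite -bars_first_swp // barred_flip /p swp_letter ?hb.
Qed.

Definition unb (s : seq elt) : bool := all (fun e => ~~ barred e.2) s.

Lemma unb_letters s : unb s = all (fun x => ~~ barred x) (letters s).
Proof. by rewrite /letters all_map. Qed.

Lemma unb_push s b : unb (push s b).2 = unb s.
Proof. by rewrite !unb_letters push_letters. Qed.

Lemma bars_first_push_flip s1 U b s2 : unb U -> barred b.2 ->
  bars_first (flips (s1 ++ U ++ b :: s2)) =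
  bars_first (flips (s1 ++ (push U b).1 :: (push U b).2 ++ s2)).
Proof.
move=> + hb; elim/last_ind: U b hb s2 => // U u IHU b hb s2.
rewrite {1}/unb all_rcons => /andP[hu hU].
rewrite push_rcons !cat_rcons catA bars_first_swp_flip //.
by rewrite -catA IHU // swp_letter.
Qed.

Lemma unb_step st e : unb st.2 -> unb (step st e).2.
Proof.
by rewrite /step; case: ifP => h hu; rewrite /= ?unb_push // /unb all_rcons h.
Qed.

Lemma foldl_step_unb st s : unb st.2 -> unb (foldl step st s).2.
Proof. by elim: s st => //= e s IHs st h; apply/IHs/unb_step. Qed.

Lemma letters_foldl_step st s :
  letters (foldl step st s).1 = letters st.1 ++ [seq x <- letters s | barred x] /\
  letters (foldl step st s).2 = letters st.2 ++ [seq x <- letters s | ~~ barred x].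
Proof.
elim: s st => [|e s IHs] st /=; first by rewrite !cats0.
have [-> ->] := IHs (step st e); rewrite /step; case: ifP => h /=.
  by rewrite push_letters /letters map_rcons push_letter cat_rcons.
by rewrite /letters map_rcons cat_rcons.
Qed.

Lemma letters_bars_first s :
  letters (bars_first s).1 = [seq x <- letters s | barred x] /\
  letters (bars_first s).2 = [seq x <- letters s | ~~ barred x].
Proof. exact: letters_foldl_step. Qed.

Lemma bars_first_rcons s e : bars_first (rcons s e) = step (bars_first s) e.
Proof. exact: foldl_rcons. Qed.

Lemma bars_first_unb s : unb s -> bars_first s = ([::], s).
Proof.
elim/last_ind: s => // s e IHs; rewrite /unb all_rcons => /andP[he /IHs hs].
by rewrite bars_first_rcons hs /step (negPf he).
Qed.

(** Sorting bars first is a sequence of interchanges, and the opposite sorting is invariant under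
    each of them. *)
Lemma bars_first_flip s :
  bars_first (flips s) = bars_first (flips ((bars_first s).1 ++ (bars_first s).2)).
Proof.
suff H r : bars_first (flips (s ++ r)) =
    bars_first (flips ((bars_first s).1 ++ (bars_first s).2 ++ r)).
  by have := H [::]; rewrite !cats0.
elim/last_ind: s r => // s e IHs r; rewrite cat_rcons IHs.
rewrite bars_first_rcons /step.
case: ifP => h /=; last by rewrite cat_rcons.
rewrite bars_first_push_flip ?cat_rcons //.
exact: (@foldl_step_unb ([::], [::])).
Qed.

Lemma foldl_step_valid st s : valid [::] (cells (st.1 ++ st.2 ++ s)) ->
  valid [::] (cells ((foldl step st s).1 ++ (foldl step st s).2)).
Proof.
elim: s st => [|e s IHs] st /=; first by rewrite cats0.
move=> sV; apply: IHs; move: sV; rewrite /step; case: ifP => h /=; last by rewrite cat_rcons.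
rewrite cat_rcons /cells !map_cat /= map_cat => /valid_cat[s1 s2].
apply/valid_cat; split=> //.
by apply: push_valid s2; apply: down_valid s1.
Qed.

Lemma bars_first_valid s : valid [::] (cells s) ->
  valid [::] (cells ((bars_first s).1 ++ (bars_first s).2)).
Proof. exact: (@foldl_step_valid ([::], [::])). Qed.

Lemma mem_foldl_step st s :
  cells ((foldl step st s).1 ++ (foldl step st s).2) =i cells (st.1 ++ st.2 ++ s).
Proof.
elim: s st => [|e s IHs] st c /=; first by rewrite cats0.
rewrite IHs /step; case: ifP => h; rewrite /= ?cat_rcons //.
rewrite /cells !map_cat !mem_cat /= inE map_cat mem_cat; congr (_ || _).
rewrite orbA -[in LHS]in_cons -mem_push /cells map_rcons mem_rcons !inE.
by rewrite -orbA orbCA.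
Qed.

Lemma mem_bars_first s :
  cells ((bars_first s).1 ++ (bars_first s).2) =i cells s.
Proof. exact: (@mem_foldl_step ([::], [::])). Qed.

Definition bounded n (s : seq cell) : bool :=
  all (fun c => (c.1 < n) && (c.2 < n)) s.

(** Every element of [Q] passes through the whole unbarred part, which is a jeu de taquin slide to
    which [push_knuth] applies. *)
Lemma foldl_step_knuth n B U Q : all (fun e => barred e.2) Q ->
  valid [::] (cells (B ++ U ++ Q)) -> bounded n (cells (U ++ Q)) ->
  knuth (cword n (cells U)) (cword n (cells (foldl step (B, U) Q).2)).
Proof.
elim: Q B U => [|b Q IHQ] B U /=; first by move=> *; exact: knuth_refl.
case/andP=> hb hQ sV sn; rewrite {2}/step hb /=.
have sV' := sV; move: sV'; rewrite /cells !map_cat => /valid_cat[BV UV].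
have UV' : valid (cells B) (cells U ++ b.1 :: cells [::]).
  by have := UV; rewrite /= -cat1s catA => /valid_cat[].
have bn : bounded n (b.1 :: cells U).
  by move: sn; rewrite /bounded /cells map_cat all_cat /= => /and3P[-> ->].
have := push_knuth (down_valid down_nil BV) UV' bn; rewrite !cats0.
move/knuth_trans; apply; apply: IHQ => //.
- rewrite cat_rcons /cells !map_cat /= map_cat; apply/valid_cat; split=> //.
  by apply: push_valid UV; exact: (down_valid down_nil BV).
- move: sn; rewrite /bounded /cells !map_cat !all_cat /= => /and3P[sU sb ->].
  rewrite andbT; have := bn; rewrite /bounded.
  have -> : all (fun c => (c.1 < n) && (c.2 < n)) (b.1 :: cells U) =
     all (fun c => (c.1 < n) && (c.2 < n)) (cells (rcons U b)).
    by rewrite /cells map_rcons all_rcons.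
  by rewrite (eq_all_r (mem_push U b)) /= => /andP[].
Qed.

(** * Transposed chains and the comparison of the two sortings *)

Lemma addable_tr D c : addable D c ->
  addable [seq (d.2, d.1) | d <- D] (c.2, c.1).
Proof.
have inj : injective (fun d : cell => (d.2, d.1)) by move=> [a b] [a' b'] [-> ->].
case=> cD h; split; first by rewrite (mem_map inj (D) c).
move=> [a b] ac ne; rewrite (mem_map inj D (b, a)); apply: h.
  by move: ac; rewrite /lec /= andbC.
by move: ne; case: (c) => ? ?; rewrite !xpair_eqE /= andbC.
Qed.

Lemma valid_tr D s : valid D s ->
  valid [seq (d.2, d.1) | d <- D] [seq (d.2, d.1) | d <- s].
Proof.
elim: s D => //= c s IHs D [cD sV]; split; first exact: addable_tr.
by rewrite -map_rcons; exact: IHs.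
Qed.

Lemma cells_flips s : cells (flips s) = [seq (d.2, d.1) | d <- cells s].
Proof. by rewrite /cells /flips -!map_comp. Qed.

Lemma valid_flips s : valid [::] (cells s) -> valid [::] (cells (flips s)).
Proof. by rewrite cells_flips; exact: valid_tr. Qed.

Lemma bounded_flips n s : bounded n (cells (flips s)) = bounded n (cells s).
Proof.
by rewrite cells_flips /bounded all_map; apply: eq_all => c; rewrite /= andbC.
Qed.

(** By [bars_first_flip] the opposite sorting may start from the sorted chain. After the flip its
    former barred part is an unbarred prefix, through which the remaining elements make complete
    passages. *)
Lemma bars_first_knuth n s : valid [::] (cells s) -> bounded n (cells s) ->
  knuth (cword n (cells (flips (bars_first s).1)))
        (cword n (cells (bars_first (flips s)).2)).
Proof.
move=> sV sn; rewrite bars_first_flip.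
have V := valid_flips (bars_first_valid sV).
have bd : bounded n (cells (flips ((bars_first s).1 ++ (bars_first s).2))).
  by rewrite bounded_flips /bounded (eq_all_r (mem_bars_first s)).
have U1 : unb (flips (bars_first s).1).
  rewrite /unb all_map; have [e _] := letters_bars_first s.
  rewrite (eq_all (a2 := preim snd barred)); last by move=> x; rewrite /= /barred negbK.
  by rewrite -all_map -/(letters _) e; exact: filter_all.
have U2 : all (fun e => barred e.2) (flips (bars_first s).2).
  rewrite all_map; have [_ e] := letters_bars_first s.
  rewrite (eq_all (a2 := preim snd (fun x => ~~ barred x))) //.
  by rewrite -all_map -/(letters _) e; exact: filter_all.
move: V bd; rewrite flips_cat; set P := flips _; set Q := flips _ => V bd.
rewrite /bars_first foldl_cat.
by rewrite -/(bars_first P) bars_first_unb //; exact: foldl_step_knuth.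
Qed.

(** * Inserting a letter that never moves *)

(** Interchanges permute the cells involved, so every barred letter that reaches [e] sits in a cell
    of [C], not adjacent to that of [e]. It passes [e] unchanged, and everything else happens as if
    [e] were absent. *)
Lemma foldl_step_insert (C : {pred cell}) e B U1 U2 s :
    ~~ barred e.2 -> {in C, forall c, ~~ adj e.1 c} ->
    {subset cells U2 <= C} -> {subset cells s <= C} ->
  exists B' U1' U2', [/\ letters U1' = letters U1,
    foldl step (B, U1 ++ U2) s = (B', U1' ++ U2'),
    foldl step (B, U1 ++ e :: U2) s = (B', U1' ++ e :: U2')
    & {subset cells U2' <= C}].
Proof.
move=> he eC; elim: s B U1 U2 => [|b s IHs] B U1 U2 UC sC /=.
  by exists B, U1, U2.
have sC' : {subset cells s <= C} by move=> c cs; apply: sC; rewrite inE cs orbT.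
rewrite /step; case: ifP => hb /=; last first.
  rewrite !rcons_cat; apply: IHs => // c; rewrite /cells map_rcons mem_rcons inE.
  by case/predU1P=> [->|/UC//]; apply: sC; exact: mem_head.
have pC : {subset (push U2 b).1.1 :: cells (push U2 b).2 <= C}.
  move=> c; rewrite -mem_push /cells map_rcons mem_rcons inE.
  by case/predU1P=> [->|/UC//]; apply: sC; exact: mem_head.
rewrite push_cat push_cat push_cons /=.
have -> : swp e (push U2 b).1 = ((push U2 b).1, e).
  by rewrite /swp (negPf (eC _ _)) // pC ?mem_head.
have [|//|B' [U1' [U2' [sz e1 e2 UC']]]] :=
  IHs (rcons B (push U1 (push U2 b).1).1) (push U1 (push U2 b).1).2 (push U2 b).2.
  by move=> c cU; apply: pC; rewrite inE cU orbT.
by exists B', U1', U2'; split=> //; rewrite sz push_letters.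
Qed.

Lemma bars_first_insert s1 e s2 :
    ~~ barred e.2 -> {in cells s2, forall c, ~~ adj e.1 c} ->
  exists B U1 U2, [/\ letters U1 = letters (bars_first s1).2,
    bars_first (s1 ++ s2) = (B, U1 ++ U2)
    & bars_first (s1 ++ e :: s2) = (B, U1 ++ e :: U2)].
Proof.
move=> he es2; rewrite /bars_first !foldl_cat -/(bars_first s1) /= {3}/step (negPf he).
have [//|//|B [U1 [U2 [sz e1 e2 _]]]] :=
  @foldl_step_insert (mem (cells s2)) e (bars_first s1).1 (bars_first s1).2 [::] s2 he es2.
exists B, U1, U2; split=> //; first by rewrite -e1 cats0 -surjective_pairing.
by rewrite -e2 cats1.
Qed.

(** * Reading words with letters *)

Definition lookup (s : seq elt) (c : cell) : letter :=
  nth dflt (letters s) (index c (cells s)).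

Lemma nth_lookup U c : c \in cells U ->
  (c, lookup U c) = nth (0, 0, dflt) U (index c (cells U)).
Proof.
move=> cU; have lt : index c (cells U) < size U by rewrite -(size_map fst) index_mem.
rewrite [RHS]surjective_pairing; congr (_, _).
  by rewrite -(nth_map _ (0, 0) fst) // nth_index.
by rewrite /lookup /letters (nth_map (0, 0, dflt)).
Qed.

Definition rrow n (s : seq elt) i : seq nat :=
  [seq unbar (lookup s (i, j)) | j <- iota 0 n & (i, j) \in cells s].

(** The map that undoes standardization: it turns the position word of a chain into its word of
    letters. *)
Definition letter_label (xs : seq letter) (i : nat) : nat := unbar (nth dflt xs i).

Definition rword n (s : seq elt) : seq nat :=
  flatten [seq rrow n s i | i <- rev (iota 0 n)].

Lemma rwordE n s : rword n s = map (letter_label (letters s)) (cword n (cells s)).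
Proof.
rewrite /cword map_flatten -map_comp; congr flatten; apply: eq_map => i.
by rewrite /= /seg -map_comp.
Qed.

Lemma lookup_insert U1 e U2 c : c != e.1 ->
  lookup (U1 ++ e :: U2) c = lookup (U1 ++ U2) c.
Proof.
move=> ce; rewrite /lookup /letters /cells !map_cat !index_cat /= eq_sym (negPf ce).
case: ifP => cU1; first by rewrite !nth_cat !size_map -(size_map fst) index_mem cU1.
rewrite !nth_cat !size_map addnS ltnNge ltnW ?ltnS ?leq_addr //=.
by rewrite subSn ?leq_addr // !addKn ltnNge leq_addr.
Qed.

Lemma mem_insert U1 e U2 c : c != e.1 ->
  (c \in cells (U1 ++ e :: U2)) = (c \in cells (U1 ++ U2)).
Proof.
by move=> ce; rewrite /cells !map_cat !mem_cat /= inE (negPf ce).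
Qed.

Lemma rrow_insert U1 e U2 n i : i != e.1.1 ->
  rrow n (U1 ++ e :: U2) i = rrow n (U1 ++ U2) i.
Proof.
move=> ie; have ne j : (i, j) != e.1 by apply: contra ie => /eqP <-.
rewrite /rrow (eq_filter (a2 := fun j => (i, j) \in cells (U1 ++ U2))).
  by apply: eq_map => j; rewrite lookup_insert.
by move=> j; rewrite mem_insert.
Qed.

Lemma lookup_cat_cons U1 e U2 : uniq (cells (U1 ++ e :: U2)) ->
  lookup (U1 ++ e :: U2) e.1 = e.2.
Proof.
rewrite /lookup /letters /cells !map_cat !index_cat cat_uniq /=.
case/and3P=> _ /norP[/negPf-> _] _.
by rewrite eqxx addn0 nth_cat !size_map ltnn subnn.
Qed.

Lemma iota_split n i : i < n -> iota 0 n = iota 0 i ++ i :: iota i.+1 (n - i.+1).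
Proof. by move=> bi; rewrite -{1}(subnKC bi) -{1}(addn1 i) -addnA iotaD. Qed.

Lemma rrow_nil n s i : (forall j, (i, j) \notin cells s) -> rrow n s i = [::].
Proof.
move=> h; rewrite /rrow (eq_filter (a2 := pred0)) ?filter_pred0 // => j.
by rewrite /= (negPf (h j)).
Qed.

(** The new letter is alone in the lowest row, which is read first. *)
Lemma rword_insert_bottom n U1 e U2 l : l < n -> e.1 = (l, 0) ->
    uniq (cells (U1 ++ e :: U2)) -> (forall c, c \in cells (U1 ++ U2) -> c.1 < l) ->
  rword n (U1 ++ e :: U2) = unbar e.2 :: rword n (U1 ++ U2).
Proof.
move=> ln el uq lt; rewrite /rword (iota_split ln) rev_cat rev_cons.
rewrite !map_cat !map_rcons !flatten_cat.
have rw : [seq rrow n (U1 ++ e :: U2) i | i <- rev (iota 0 l)] =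
            [seq rrow n (U1 ++ U2) i | i <- rev (iota 0 l)].
  apply/eq_in_map => i; rewrite mem_rev mem_iota => il.
  by apply: rrow_insert; rewrite el /=; lia.
have hi s : (forall c, c \in cells s -> c.1 <= l) ->
    flatten [seq rrow n s i | i <- rev (iota l.+1 (n - l.+1))] = [::].
  move=> hs; elim: (n - l.+1) => // m IHm.
  rewrite -(addn1 m) iotaD rev_cat map_cat flatten_cat IHm /= !cats0 rrow_nil // => j.
  by apply/negP=> /hs /=; lia.
rewrite -!cats1 !flatten_cat !hi /= ?cats0 ?rw; last first.
- move=> c; have [->|ce] := eqVneq c e.1; first by rewrite el.
  by rewrite mem_insert // => /lt/ltnW.
- by move=> c /lt/ltnW.
rewrite [rrow n (U1 ++ U2) l]rrow_nil; last by move=> j; apply/negP=> /lt; rewrite ltnn.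
suff -> : rrow n (U1 ++ e :: U2) l = [:: unbar e.2] by [].
rewrite /rrow (eq_in_filter (a2 := pred1 0)).
  by rewrite filter_pred1_uniq ?iota_uniq ?mem_iota /= -?el ?lookup_cat_cons //; lia.
move=> j _ /=; have [->|j0] := eqVneq j 0.
  by rewrite -el /cells map_cat mem_cat /= inE eqxx orbT.
rewrite mem_insert ?el ?xpair_eqE ?(negPf j0) ?andbF //.
by apply/negP=> /lt; rewrite ltnn.
Qed.

(** The new letter is at the right end of the top row, which is read last. *)
Lemma rword_insert_right n U1 e U2 l : l < n -> e.1 = (0, l) ->
    uniq (cells (U1 ++ e :: U2)) -> (forall c, c \in cells (U1 ++ U2) -> c.2 < l) ->
  rword n (U1 ++ e :: U2) = rcons (rword n (U1 ++ U2)) (unbar e.2).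
Proof.
move=> ln el uq lt; rewrite /rword.
have n0 : 0 < n by exact: leq_ltn_trans ln.
rewrite (iota_split n0) /= rev_cons !map_rcons -!cats1 !flatten_cat /= !cats0 -catA.
congr (_ ++ _).
  congr flatten; apply/eq_in_map => i; rewrite mem_rev mem_iota => il.
  by apply: rrow_insert; rewrite el /=; lia.
rewrite /rrow (iota_split ln) !filter_cat !map_cat /= -el.
have -> : e.1 \in cells (U1 ++ e :: U2) by rewrite /cells map_cat mem_cat /= inE eqxx orbT.
have -> : e.1 \in cells (U1 ++ U2) = false by apply/negP=> /lt; rewrite el ltnn.
rewrite /= -el lookup_cat_cons //.
have hi j : l < j -> ((0, j) \in cells (U1 ++ U2)) = false.
  by move=> lj; apply/negP=> /lt /=; lia.
rewrite (eq_in_filter (a2 := pred0) (s := iota l.+1 _)) ?filter_pred0; last first.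
  move=> j; rewrite mem_iota => /andP[lj _].
  by rewrite mem_insert ?hi // el xpair_eqE; lia.
rewrite (eq_in_filter (a2 := pred0) (s := iota l.+1 _)) ?filter_pred0; last first.
  by move=> j; rewrite mem_iota => /andP[lj _]; rewrite hi.
rewrite /= cats0; congr (_ ++ _).
have ne j : j < l -> (0, j) != e.1 by move=> jl; rewrite el xpair_eqE; lia.
rewrite (eq_in_filter (a2 := fun j => (0, j) \in cells (U1 ++ U2))).
  apply/eq_in_map => j; rewrite mem_filter mem_iota => /and3P[_ _ jl].
  by rewrite lookup_insert // ne.
by move=> j; rewrite mem_iota => /andP[_ jl]; rewrite mem_insert // ne.
Qed.

(** * Standardization *)

(* The condition for [f] to turn the standard word [w] into a word whose
   standardization is [w]: equal letters are numbered from left to right. *)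
Definition standardizes (f : nat -> nat) (w : seq nat) : bool :=
  pairwise (fun p q => if p < q then f p <= f q else f q < f p) w.

Lemma standardizes_swap f u v z x : x < z -> f x < f z ->
  standardizes f (u ++ [:: z, x & v]) = standardizes f (u ++ [:: x, z & v]).
Proof.
move=> xz fxz; rewrite /standardizes !pairwise_cat /= !allrel_consr.
have -> : (z < x) = false by lia.
rewrite xz fxz (ltnW fxz) /=.
by congr (_ && _); [rewrite andbCA | congr (_ && _); rewrite andbCA].
Qed.

Lemma standardizes_infix f u v w : standardizes f (u ++ v ++ w) -> standardizes f v.
Proof. by rewrite /standardizes !pairwise_cat => /and5P[]. Qed.

(** The order in which the witness and the two exchanged letters occur decides which inequalities
    between their images are strict. They are those of the same elementary relation, and the
    exchange preserves the standardization condition. *)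
Lemma knuth_map f u v : knuth u v ->
  standardizes f u = standardizes f v /\
  (standardizes f u -> knuth (map f u) (map f v)).
Proof.
elim=> {u v} [u v x y z xy yz|u v x y z xy yz|u|u v _ [e h]|u v w _ [e1 h1] _ [e2 h2]].
- have [xz yx zx] : [/\ x < z, (y < x) = false & (z < x) = false] by split; lia.
  (* Here [y] precedes the smaller [x], so the images of [x] and [y] differ; [y = z] would
     contradict the condition. *)
  have lt w : standardizes f w -> w \in [:: [:: y; z; x]; [:: y; x; z]] ->
      f x < f y /\ f y <= f z.
    move=> hw; rewrite !inE => /orP[] /eqP e; move: hw; rewrite e /standardizes /=;
      rewrite ?xz ?zx ?yx; case: (ltngtP y z) yz => // [_|->] _; rewrite ?ltnn;
      lia.
  have e : standardizes f (u ++ [:: y; z; x] ++ v) =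
      standardizes f (u ++ [:: y; x; z] ++ v).
    have sw : f x < f z -> standardizes f (u ++ [:: y; z; x] ++ v) =
        standardizes f (u ++ [:: y; x; z] ++ v).
      move=> fxz; have := @standardizes_swap f (rcons u y) v z x xz fxz.
      by rewrite !cat_rcons.
    by apply/idP/idP => h; have [|fxy fyz] := lt _ (standardizes_infix h);
      rewrite ?inE ?eqxx ?orbT // ?sw // -?sw //; exact: leq_trans fxy fyz.
  split=> // h; rewrite !map_cat /=; apply: knuth_yzx;
    by have [|] := lt _ (standardizes_infix h); rewrite ?inE ?eqxx.
- have [xz zy zx] : [/\ x < z, (z < y) = false & (z < x) = false] by split; lia.
  have lt w : standardizes f w -> w \in [:: [:: x; z; y]; [:: z; x; y]] ->
      f x <= f y /\ f y < f z.
    move=> hw; rewrite !inE => /orP[] /eqP e; move: hw; rewrite e /standardizes /=;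
      rewrite ?xz ?zx ?zy; case: (ltngtP x y) xy => // [_|->] _; rewrite ?ltnn;
      lia.
  have e : standardizes f (u ++ [:: x; z; y] ++ v) =
      standardizes f (u ++ [:: z; x; y] ++ v).
    have sw : f x < f z -> standardizes f (u ++ [:: x; z; y] ++ v) =
        standardizes f (u ++ [:: z; x; y] ++ v).
      by move=> fxz; have := @standardizes_swap f u (y :: v) z x xz fxz.
    by apply/idP/idP => h; have [|fxy fyz] := lt _ (standardizes_infix h);
      rewrite ?inE ?eqxx ?orbT // ?sw // -?sw //; exact: leq_ltn_trans fxy fyz.
  split=> // h; rewrite !map_cat /=; apply: knuth_xzy;
    by have [|] := lt _ (standardizes_infix h); rewrite ?inE ?eqxx.
- by split=> // _; exact: knuth_refl.
- by split=> // hv; apply/knuth_sym/h; rewrite e.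
- split=> [|hu]; first by rewrite e1.
  by apply: knuth_trans (h1 hu) (h2 _); rewrite -e1.
Qed.

(* Equal letters form a horizontal strip, filled from left to right. *)
Definition strip_le (e e' : elt) : bool :=
  (unbar e.2 < unbar e'.2) ||
  [&& unbar e.2 == unbar e'.2, e.1.2 < e'.1.2 & e'.1.1 <= e.1.1].

Lemma strip_le_trans : transitive strip_le.
Proof.
move=> [[a b] [? x]] [[a' b'] [? x']] [[a'' b''] [? x'']].
by rewrite /strip_le /=; lia.
Qed.

Definition read_before (c d : cell) : bool :=
  (d.1 < c.1) || (c.1 == d.1) && (c.2 < d.2).

Definition reading_cells n : seq cell :=
  flatten [seq [seq (i, j) | j <- iota 0 n] | i <- rev (iota 0 n)].

Lemma cword_reading n s :
  cword n s = [seq index c s | c <- reading_cells n & c \in s].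
Proof.
rewrite /reading_cells filter_flatten map_flatten -!map_comp; congr flatten.
apply: eq_map => i; rewrite /= /seg filter_map -map_comp.
by [].
Qed.

Lemma pairwise_reading n : pairwise read_before (reading_cells n).
Proof.
rewrite /reading_cells; elim: {2}n => [|m IHm] //.
rewrite -(addn1 m) iotaD rev_cat /= pairwise_cat IHm andbT.
apply/andP; split.
  apply/allrelP => c d /mapP[j _ ->] /flatten_mapP[i].
  by rewrite mem_rev mem_iota => im /mapP[k _ ->]; rewrite /read_before /=; lia.
rewrite pairwise_map; apply: (sub_pairwise (r := ltn)).
  by move=> j k jk; rewrite /read_before /= eqxx; move: jk => /= ->; rewrite orbT.
by rewrite -(sorted_pairwise ltn_trans) iota_ltn_sorted.
Qed.

(** In a horizontal strip, going right means going weakly up, so equal letters are read in the order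
    in which the chain lists them. *)
Lemma strip_standardizes n U : uniq (cells U) -> sorted strip_le U ->
  standardizes (letter_label (letters U)) (cword n (cells U)).
Proof.
move=> uq; rewrite (sorted_pairwise strip_le_trans) => /(pairwiseP (0, 0, dflt)) sU.
rewrite cword_reading /standardizes pairwise_map.
have sub c d : c \in cells U -> d \in cells U ->
   index c (cells U) < index d (cells U) ->
   strip_le (c, lookup U c) (d, lookup U d).
  move=> cU dU cd; rewrite !nth_lookup //; apply: sU => //.
    by rewrite inE -(size_map fst) index_mem.
  by rewrite inE -(size_map fst) index_mem.
apply: (sub_in_pairwise (r := read_before)
  (P := mem [seq c <- reading_cells n | c \in cells U])).
- move=> c d; rewrite !mem_filter => /andP[cU _] /andP[dU _] cd /=.
  case: (ltngtP (index c (cells U)) (index d (cells U))) => [lt|lt|e].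
  + by have := sub _ _ cU dU lt; rewrite /strip_le /letter_label /lookup /=; lia.
  + have := sub _ _ dU cU lt; move: cd.
    by rewrite /read_before /strip_le /letter_label /lookup /=; lia.
  + move: cd; have -> : c = d by rewrite -(nth_index (0, 0) cU) e nth_index.
    by rewrite /read_before ltnn eqxx ltnn.
- exact/allP.
- exact/pairwise_filter/pairwise_reading.
Qed.

(** Transfers an equivalence of position words to the words of letters. *)
Lemma strip_knuth n U V : uniq (cells U) -> sorted strip_le U ->
  letters U = letters V -> knuth (cword n (cells U)) (cword n (cells V)) ->
  knuth (rword n U) (rword n V).
Proof.
move=> uq sU e /(@knuth_map (letter_label (letters U)))[_].
by rewrite !rwordE -e; apply; exact: strip_standardizes.
Qed.

(** * Horizontal strips under a passing barred letter *)

Definition strip_cells (c d : cell) : bool := (c.2 < d.2) && (d.1 <= c.1).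

Lemma in_rcons (s : seq cell) c d : (c \in rcons s d) = (c == d) || (c \in s).
Proof. by rewrite mem_rcons inE. Qed.

(** The strip could break only if [u] moved down out of the row of [w], or [w] moved right into the
    column of [u]. Addability of [h] excludes both. *)
Lemma strip_push2 D w u h : down D -> valid D [:: w.1; u.1; h.1] ->
  strip_cells w.1 u.1 ->
  strip_cells (swp w (swp u h).1).2.1 (swp u h).2.1.
Proof.
case: w u h => [[a b] x] [[a' b'] y] [[a'' b''] z] /= dD.
move=> [[nw hw] [[nu hu] [[nh hh] _]]].
have below c d : (c, d) \in D -> ~~ (lec (a, b) (c, d) || lec (a', b') (c, d)).
  move=> cD; apply/norP; split; apply/negP => /dD /(_ cD).
    by rewrite (negPf nw).
  by apply/negP; apply: contra nu; rewrite in_rcons => ->; rewrite orbT.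
(* A cell northwest of [h] is [u], [w] or in [D], and cells of [D] are southeast of neither [u] nor
   [w]. *)
have H c d : c <= a'' -> d <= b'' -> (c == a'') && (d == b'') = false ->
  [|| (c == a') && (d == b'), (c == a) && (d == b) |
      ~~ ((a <= c) && (b <= d) || (a' <= c) && (b' <= d))].
  move=> ca db ne; have := hh (c, d); rewrite /lec /= ca db xpair_eqE ne.
  move=> /(_ isT isT); rewrite !in_rcons !xpair_eqE.
  by case/or3P=> [->|->|/below]; rewrite ?orbT // /lec /= => ->; rewrite !orbT.
have F1 : ~~ ((a'' <= a') && (b'' <= b')).
  apply: contra nh => le; rewrite in_rcons; case: eqP => //= /eqP ne.
  by apply: hu => //; rewrite eq_sym.
have F2 : ~~ ((a'' <= a) && (b'' <= b)).
  apply: contra nh => le; rewrite !in_rcons; case: eqP => //= _.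
  by case: eqP => //= /eqP ne; apply: hw => //; rewrite eq_sym.
have := H a''.-1 b''; have := H a'' b''.-1; have := H a'' b; have := H a'' b'.
rewrite /strip_cells /= => H1 H2 H3 H4 /andP[ab aa].
clear dD nw hw nu hu nh hh below D H; rewrite /swp /=.
case uh: (adj (a', b') (a'', b'')) => /=.
  have [[? ?]|[? ?]] : (a'' = a' /\ b'' = b'.+1) \/ (a'' = a'.+1 /\ b'' = b').
  - by clear H1 H2 H3 H4 F2; move: uh F1; rewrite /adj /=; lia.
  - subst a'' b''; clear H1 H2 H3 H4 F1 F2 uh.
    by case wh: (adj (a, b) (a', b')) => /=; move: wh; rewrite /adj /=; lia.
  (* [u] moves down. If [w] were in the row of [u], the left neighbor of [h] would be southeast of
     [w] without being [u] or [w]. *)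
  - subst a'' b''; clear H1 H2 H4 F1 F2 uh.
    case wh: (adj (a, b) (a', b')) => /=; last by clear wh; move: H3 => /=; lia.
    have [? ?] : a = a' /\ b' = b.+1 by clear H3; move: wh; rewrite /adj /=; lia.
    by subst a b'; clear wh; lia.
case wh: (adj (a, b) (a'', b'')) => /=; last by rewrite ab aa.
have [[? ?]|[? ?]] : (a'' = a /\ b'' = b.+1) \/ (a'' = a.+1 /\ b'' = b).
- by clear H1 H2 H3 H4 F1 uh; move: wh F2; rewrite /adj /=; lia.
- subst a'' b''; clear H1 H2 H3 F2 wh.
  move: uh; rewrite /adj /= => uh.
  (* [w] moves right. If [u] were in the column of [h], the upper neighbor of [h] would have to be
     [u], but [u] and [h] are not adjacent here. *)
  case: (ltnP b.+1 b') => [lt|ge]; first by clear -lt aa; lia.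
  have ? : b' = b.+1 by clear -ge ab; lia.
  by subst b'; clear ge ab; move: uh H4 F1 => /=; lia.
- by subst a'' b''; clear -ab aa; lia.
Qed.

Lemma strip_push D U h : down D -> valid D (cells U ++ [:: h.1]) ->
  sorted strip_le U -> sorted strip_le (push U h).2.
Proof.
elim: U D => // w U IHU D dD [wD UV] sU; rewrite push_cons.
have dDw := down_addable dD wD.
case: U IHU UV sU => [|u U] IHU UV sU; first by [].
have /andP[wu uU] : strip_le w u && sorted strip_le (u :: U) by [].
 have IH := IHU _ dDw UV uU.
have [uD UV'] := UV.
have V := push_valid (down_addable dDw uD) UV'.
rewrite !push_cons in IH *; set b := push U h in V IH *.
rewrite /= in IH *; rewrite IH andbT /strip_le !swp_letter.
move: wu; rewrite /strip_le => /orP[->//|/and3P[e wu1 wu2]].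
apply/orP; right; rewrite e /=; apply: (strip_push2 (D := D)) => //.
  by case: V => bD _; do 2!split=> //.
by rewrite /strip_cells wu1.
Qed.

(* By the last hypothesis no barred letter comes between two equal unbarred
   ones, so that every gap moves through both of them. *)
Lemma strip_bars_first s : valid [::] (cells s) ->
    (forall s1 s2 e e', s = s1 ++ s2 -> e \in s1 -> e' \in s2 ->
       ~~ barred e.2 -> ~~ barred e'.2 -> strip_le e e') ->
    (forall s1 b s2 e e', s = s1 ++ b :: s2 -> barred b.2 -> e \in s1 ->
       e' \in s2 -> ~~ barred e.2 -> ~~ barred e'.2 -> unbar e.2 < unbar e'.2) ->
  sorted strip_le (bars_first s).2.
Proof.
elim/last_ind: s => // s e IHs sV h1 h2.
have sV' : valid [::] (cells s).
  by move: sV; rewrite /cells map_rcons -cats1 => /valid_cat[].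
have IH : sorted strip_le (bars_first s).2.
  apply: IHs => //.
    move=> s1 s2 x x' es xs xs'; apply: (h1 s1 (rcons s2 e)) => //.
      by rewrite es rcons_cat.
    by rewrite mem_rcons inE xs' orbT.
  move=> s1 b s2 x x' es hb xs xs'; apply: (h2 s1 b (rcons s2 e)) => //.
    by rewrite es rcons_cat.
  by rewrite mem_rcons inE xs' orbT.
rewrite bars_first_rcons /step; case: ifP => he /=.
  have V := bars_first_valid sV'.
  have V' : valid [::] (cells ((bars_first s).1 ++ (bars_first s).2 ++ [:: e])).
    rewrite catA /cells map_cat; apply/valid_cat; split=> //.
    move: sV; rewrite /cells map_rcons -cats1 => /valid_cat[_].
    by apply: valid_eq => c; rewrite !cat0s -/(cells _) mem_bars_first.
  move: V'; rewrite /cells !map_cat => /valid_cat[V1 V2].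
  exact: strip_push (down_valid down_nil V1) V2 IH.
rewrite (sorted_pairwise strip_le_trans) pairwise_rcons
  -(sorted_pairwise strip_le_trans) IH andbT.
have [_ eU] := letters_bars_first s.
case/lastP: s => [|s f] in IHs sV h1 h2 sV' IH eU *; first by [].
apply/allP => x /= xU; case hf: (barred f.2); last first.
  have fe : strip_le f e.
    apply: (h1 (rcons s f) [:: e]); rewrite ?cats1 ?mem_rcons ?inE ?eqxx //.
      by rewrite hf.
    by rewrite he.
  move: IH xU; rewrite bars_first_rcons /step hf /= (sorted_pairwise strip_le_trans).
  rewrite pairwise_rcons mem_rcons inE => /andP[/allP IH _] /predU1P[->//|/IH /= xf].
  exact: strip_le_trans xf fe.
have : x.2 \in letters (bars_first (rcons s f)).2 by apply: map_f.
rewrite eU mem_filter => /andP[hx /mapP[y ys exy]].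
have {}ys : y \in s.
  by move: ys; rewrite mem_rcons inE => /predU1P[ey|//]; move: hx; rewrite exy ey hf.
rewrite /strip_le exy (h2 s f [:: e] y e) ?mem_head ?he //; last by rewrite -exy.
by rewrite -!cats1 -catA.
Qed.

(** * Conversion as sorting of a chain *)

Definition realizes (T : filling) (s : seq elt) : Prop :=
  (forall c, in_diagram T c = (c \in cells s)) /\
  (forall e, e \in s -> entry dflt T e.1 = e.2).

Lemma entry_set T c x d :
  entry dflt (set_entry dflt T c x) d = if d == c then x else entry dflt T d.
Proof.
case: c d => [i j] [i' j']; rewrite /entry /set_entry nth_set_nth /= xpair_eqE.
by have [->|ni] //= := eqVneq i' i; rewrite nth_set_nth /=.
Qed.

Lemma in_diagram_set T c x d : in_diagram T c ->
  in_diagram (set_entry dflt T c x) d = in_diagram T d.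
Proof.
case: c d => [i j] [i' j']; rewrite /in_diagram /set_entry nth_set_nth /=.
have [->|//] := eqVneq i' i; rewrite size_set_nth => h.
by rewrite (maxn_idPr h).
Qed.

Lemma realizes_eq T s s' : s =i s' -> realizes T s -> realizes T s'.
Proof.
move=> e [h1 h2]; split=> [c|x]; last by rewrite -e; exact: h2.
by rewrite h1; apply/idP/idP => /mapP[x xs ->]; apply: map_f; rewrite ?e // -e.
Qed.

Lemma realizes_exchange T s1 c x d y s2 :
    uniq (cells (s1 ++ [:: (c, x), (d, y) & s2])) ->
    realizes T (s1 ++ [:: (c, x), (d, y) & s2]) ->
  realizes (exchange dflt T d c) (s1 ++ [:: (c, y), (d, x) & s2]).
Proof.
move=> uq [h1 h2].
have cT : entry dflt T c = x.
  by apply: (h2 (c, x)); rewrite mem_cat !inE eqxx orbT.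
have dT : entry dflt T d = y.
  by apply: (h2 (d, y)); rewrite mem_cat !inE eqxx !orbT.
have cD : in_diagram T c by rewrite h1 /cells map_cat mem_cat /= !inE eqxx orbT.
have dD : in_diagram T d by rewrite h1 /cells map_cat mem_cat /= !inE eqxx !orbT.
rewrite /exchange; split=> [e|e].
  by rewrite in_diagram_set ?in_diagram_set // h1 /cells !map_cat !mem_cat /= !inE.
move: uq; rewrite /cells map_cat uniq_catC /= !inE negb_or => /and3P[/andP[cd nc] nd _].
have other : e \in s1 \/ e \in s2 -> entry dflt T e.1 = e.2 /\ e.1 != c /\ e.1 != d.
  move=> es; have e1 : e.1 \in map fst s2 ++ map fst s1.
    by rewrite mem_cat; case: es => /(map_f fst) ->; rewrite ?orbT.
  split; first by apply: h2; rewrite mem_cat !inE; case: es => ->; rewrite ?orbT.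
  by split; [apply: contraNneq nc => <- | apply: contraNneq nd => <-].
rewrite !entry_set cT dT mem_cat !inE => /or4P[es|||].
- by have [|-> [/negPf-> /negPf->]] := other; first by left.
- by move/eqP->; rewrite eqxx.
- by move/eqP->; rewrite /= eq_sym (negPf cd) eqxx.
- by move=> es; have [|-> [/negPf-> /negPf->]] := other; first by right.
Qed.

Lemma greater_neighborP k T c d : greater_neighbor k T c = Some d ->
  c = (d.1.+1, d.2) \/ c = (d.1, d.2.+1).
Proof.
case: c => [[|i] [|j]] //= [] <-; [by right|by left|].
by case: ifP; [left | right].
Qed.

Lemma rank_barred k n : n <= k -> rank k (true, n) = n.
Proof. by rewrite /rank /= => ->. Qed.

Lemma rank_unbarred k n : n <= k -> rank k (false, n) = k + n.
Proof. by rewrite /rank /= => ->. Qed.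

(** The last unbarred element [u] before [b] is the greatest entry there. If its cell is adjacent to
    that of [b], it is the greater neighbor and the slide exchanges the two; otherwise [b] passes it
    in the chain and the filling is unchanged. *)
Lemma slide_realizes k n T B U b rest :
    valid [::] (cells (B ++ U ++ b :: rest)) ->
    all (fun e => barred e.2 && (unbar e.2 <= k)) B ->
    all (fun e => [&& ~~ barred e.2, 0 < unbar e.2 & unbar e.2 <= k]) U ->
    b.2 = (true, k) -> sorted strip_le U -> n = b.1.1 + b.1.2 ->
    realizes T (B ++ U ++ b :: rest) ->
  realizes (slide k n T b.1) (B ++ (push U b).1 :: (push U b).2 ++ rest).
Proof.
elim/last_ind: U n T b rest => [|U u IHU] n T b rest sV hB.
  move=> _ hb _ _ /= RT.
  suff -> : slide k n T b.1 = T by [].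
  case: n => //= n; case e: greater_neighbor => [d|//].
  (* With no unbarred element left, the neighbors carry barred letters up to [k], none of them
     greater, and the slide stops. *)
  have /mapP[f fB ef] : d \in cells B.
    move: sV; rewrite /cells map_cat => /valid_cat[_ [[_ h] _]].
    case: (greater_neighborP e) => eb; apply: h; rewrite eb /lec ?leqnn ?leqnSn //;
      by case: (d) => ? ?; rewrite xpair_eqE /=; lia.
  rewrite /ltk ef !RT.2 ?mem_cat ?fB ?inE ?eqxx ?orbT // hb rank_barred //.
  have /andP[] := allP hB f fB; case: (f.2) => [[] m] //= _ mk.
  by rewrite rank_barred // ltnNge mk.
rewrite all_rcons => /andP[/and3P[ub u0 uk] hU] hb sU en RT.
have eu : u.2 = (false, unbar u.2) by move: ub; case: (u.2) => [[]].
have sU' : sorted strip_le U.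
  by move: sU; rewrite !(sorted_pairwise strip_le_trans) pairwise_rcons => /andP[].
rewrite !cat_rcons in sV RT.
rewrite push_rcons cat_rcons.
have sV' : valid [::] (cells (B ++ U ++ (swp u b).1 :: (swp u b).2 :: rest)).
  move: sV; rewrite !catA /cells !map_cat => /valid_cat[s1 s2].
  by apply/valid_cat; split=> //; apply: swp_valid s2; exact: (down_valid down_nil s1).
case ad: (adj u.1 b.1); last first.
  have eb : swp u b = (b, u) by rewrite /swp ad.
  rewrite eb /= in sV' *; apply: IHU => //.
  by apply: realizes_eq RT => x; rewrite !mem_cat !inE (orbCA (x == u)).
have eb : swp u b = ((u.1, b.2), (b.1, u.2)) by rewrite /swp ad.
rewrite eb /= in sV' *.
have lt_ub : ~~ lec b.1 u.1.
  move: sV; rewrite catA /cells map_cat => /valid_cat[_ [[_ hu] [[hbn _] _]]].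
  apply/negP=> bu; move: hbn; rewrite in_rcons.
  by case: eqP => //= /eqP ne; rewrite hu.
have ET e : e \in B ++ U ++ [:: u, b & rest] -> entry dflt T e.1 = e.2 by exact: RT.2.
have eTb : entry dflt T b.1 = b.2 by apply: ET; rewrite !mem_cat !inE eqxx !orbT.
have eTu : entry dflt T u.1 = u.2 by apply: ET; rewrite !mem_cat !inE eqxx !orbT.
(* Any other cell northwest of [b] has a smaller letter than [u], or an equal one strictly to the
   left; the latter settles the tie rule of [greater_neighbor]. *)
have other d : lec d b.1 -> d != b.1 -> d != u.1 ->
    rank k (entry dflt T d) <= rank k u.2 /\
    (d.2 < u.1.2 \/ rank k (entry dflt T d) < rank k u.2).
  move=> db nb nu; rewrite eu rank_unbarred //.
  have : d \in cells (B ++ U).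
    move: sV; rewrite catA /cells map_cat => /valid_cat[_ [_ [[_ h] _]]].
    by have := h d db nb; rewrite in_rcons (negPf nu).
  case/mapP=> f; rewrite mem_cat => fBU ->.
  rewrite ET; last by rewrite catA mem_cat mem_cat fBU.
  case/orP: fBU => fs.
    have /andP[] := allP hB f fs; case: (f.2) => [[] m] //= _ mk.
    by rewrite rank_barred //; lia.
  have /and3P[] := allP hU f fs; case ef: (f.2) => [[] m] //= _ _ mk.
  rewrite rank_unbarred //; move: sU; rewrite (sorted_pairwise strip_le_trans).
  rewrite pairwise_rcons => /andP[/allP /(_ f fs) + _].
  rewrite /= /strip_le ef /=; case/orP=> [|/and3P[]]; clear; first by lia.
  by move=> /eqP-> ? _; split=> //; left.
have gn : greater_neighbor k T b.1 = Some u.1.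
  have [e1|e1] : b.1 = (u.1.1.+1, u.1.2) \/ b.1 = (u.1.1, u.1.2.+1).
  - move: ad lt_ub; clear; case: (u.1) (b.1) => [p q] [p' q']; rewrite /adj /lec /= => *.
    by case: (ltnP p p') => ?; [left|right]; congr (_, _); lia.
  - rewrite e1 /=; case eq2: (u.1.2) => [|j]; first by rewrite -eq2 -surjective_pairing.
    rewrite /lek -eq2 -surjective_pairing eTu.
    have [||| -> _] // := other (u.1.1.+1, j).
    + by rewrite e1 /lec /=; lia.
    + by rewrite e1 xpair_eqE; lia.
    + by case: (u.1) => ? ?; rewrite xpair_eqE /=; lia.
  - rewrite e1 /=; case eq1: (u.1.1) => [|i]; first by rewrite -eq1 -surjective_pairing.
    rewrite /lek -eq1 -surjective_pairing eTu.
    have [||| _ []] := other (i, u.1.2.+1).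
    + by rewrite e1 /lec /=; lia.
    + by rewrite e1 xpair_eqE /=; lia.
    + by case: (u.1) => ? ?; rewrite xpair_eqE /=; lia.
    + by rewrite /=; lia.
    + by rewrite ltnNge => /negPf->.
have lt : ltk k (entry dflt T b.1) (entry dflt T u.1).
  by rewrite /ltk eTb eTu hb eu rank_barred // rank_unbarred //; lia.
have : n = (u.1.1 + u.1.2).+1.
  by rewrite en; case: (greater_neighborP gn) => -> /=; lia.
case: n en => // n en [en']; rewrite /= gn lt.
have -> : u.1 = (u.1, b.2).1 by [].
apply: IHU => //.
rewrite catA.
have := @realizes_exchange T (B ++ U) u.1 u.2 b.1 b.2 rest.
rewrite -!surjective_pairing -catA; apply=> //.
exact: valid_uniq sV.
Qed.

Lemma all_letters_push (P : pred letter) s b :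
  all (fun e => P e.2) (push s b).2 = all (fun e => P e.2) s.
Proof.
have H t : all (fun e : elt => P e.2) t = all P (letters t) by rewrite /letters all_map.
by rewrite !H push_letters.
Qed.

Lemma foldl_slide_realizes k T B U blk rest :
    valid [::] (cells (B ++ U ++ blk ++ rest)) ->
    all (fun e => barred e.2 && (unbar e.2 <= k)) B ->
    all (fun e => [&& ~~ barred e.2, 0 < unbar e.2 & unbar e.2 <= k]) U ->
    all (fun e => e.2 == (true, k)) blk -> sorted strip_le U ->
    realizes T (B ++ U ++ blk ++ rest) ->
  let st := foldl step (B, U) blk in
  realizes (foldl (fun V c => slide k (c.1 + c.2) V c) T (cells blk))
    (st.1 ++ st.2 ++ rest).
Proof.
elim: blk T B U => [|b blk IHb] T B U //= sV hB hU /andP[/eqP hb hblk] sU RT.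
have -> : step (B, U) b = (rcons B (push U b).1, (push U b).2) by rewrite /step hb.
move: sV; rewrite /cells !map_cat /= => /valid_cat[V1 V2].
have V3 := push_valid (down_valid down_nil V1) V2.
apply: IHb => //.
- rewrite cat_rcons /cells map_cat /= !map_cat; apply/valid_cat; split=> //.
  by move: V3; rewrite map_cat.
- by rewrite all_rcons push_letter hb /= leqnn.
- by rewrite (all_letters_push (fun x => [&& ~~ barred x, 0 < unbar x & unbar x <= k])).
- apply: (strip_push (down_valid down_nil V1)) => //.
  by move: V2; rewrite /= -cat1s catA => /valid_cat[].
- rewrite cat_rcons; apply: slide_realizes => //.
  by rewrite /cells !map_cat /= map_cat; apply/valid_cat; split; rewrite -?map_cat.
Qed.

(** Both lists have the same members and strictly increasing rows. *)
Lemma occurrencesE T s1 blk s2 x :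
    uniq (cells (s1 ++ blk ++ s2)) -> realizes T (s1 ++ blk ++ s2) ->
    all (fun e => e.2 != x) s1 -> all (fun e => e.2 != x) s2 ->
    all (fun e => e.2 == x) blk ->
    pairwise (fun e e' : elt => e.1.1 < e'.1.1) blk ->
  occurrences T x = cells blk.
Proof.
move=> uq RT n1 n2 hb pb.
pose lt (c d : cell) := c.1 < d.1.
have ltt : transitive lt by move=> c d e; exact: ltn_trans.
have lti : irreflexive lt by move=> c; exact: ltnn.
have sb : sorted lt (cells blk).
  by rewrite (sorted_pairwise ltt) /cells pairwise_map.
have so : sorted lt (occurrences T x).
  rewrite (sorted_pairwise ltt) /occurrences pairwise_map.
  apply: pairwise_filter; rewrite -(sorted_pairwise (leT := fun i j => i < j)).
    exact: iota_ltn_sorted.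
  exact: ltn_trans.
apply: (irr_sorted_eq ltt lti so sb) => c.
have blkP d : in_diagram T d -> entry dflt T d = x -> d \in cells blk.
  rewrite RT.1 => /mapP[e es ->]; rewrite RT.2 // => ex; apply: map_f.
  move: es; rewrite !mem_cat => /or3P[es|//|es].
    by have := allP n1 e es; rewrite ex eqxx.
  by have := allP n2 e es; rewrite ex eqxx.
apply/idP/idP.
  case/mapP=> i; rewrite mem_filter => /andP[xi _] ->; apply: blkP.
    by rewrite /in_diagram index_mem.
  by rewrite /entry nth_index.
move=> cb; case/mapP: (cb) => e eb ec.
have es : e \in s1 ++ blk ++ s2 by rewrite !mem_cat eb orbT.
have cD : in_diagram T c by rewrite RT.1 ec; exact: map_f.
have cx : entry dflt T c = x by rewrite ec RT.2 // (eqP (allP hb e eb)).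
have xr : x \in nth [::] T c.1 by rewrite -cx; exact: mem_nth.
have c1 : c.1 < size T.
  by rewrite ltnNge; apply/negP=> h; move: xr; rewrite nth_default.
suff -> : c = (c.1, index x (nth [::] T c.1)).
  by apply/mapP; exists c.1; rewrite // mem_filter xr mem_iota.
have db : (c.1, index x (nth [::] T c.1)) \in cells blk.
  by apply: blkP; rewrite /in_diagram /entry /= ?index_mem ?nth_index.
move: sb; rewrite (sorted_pairwise ltt) => /(pairwiseP (0, 0)) sb.
set d := (c.1, _) in db *.
have [lt1|lt1|e1] := ltngtP (index c (cells blk)) (index d (cells blk)).
- have := sb _ _ _ _ lt1; rewrite !inE !index_mem cb db !nth_index // /lt ltnn.
  by move/(_ isT isT).
- have := sb _ _ _ _ lt1; rewrite !inE !index_mem cb db !nth_index // /lt ltnn.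
  by move/(_ isT isT).
- by rewrite -(nth_index (0, 0) cb) e1 nth_index.
Qed.

(* The natural order with its tie-breaking rule. *)
Definition chain_lt (e e' : elt) : bool :=
  ltk 1 e.2 e'.2 || (e.2 == e'.2) &&
    (if barred e.2 then (e.1.1 < e'.1.1) && (e'.1.2 <= e.1.2)
     else (e.1.2 < e'.1.2) && (e'.1.1 <= e.1.1)).

Record chain_of (T : filling) (s : seq elt) : Prop := ChainOf {
  chain_realizes : realizes T s;
  chain_valid : valid [::] (cells s);
  chain_positive : all (fun e => 0 < unbar e.2) s;
  chain_sorted : pairwise chain_lt s
}.

(** * Cutting a chain by ranks and converting it step by step *)

Lemma rank1E x : 0 < unbar x -> rank 1 x = (unbar x).*2 - barred x.
Proof.
by case: x => [[] [|[|n]]] //= _; rewrite /rank /=; lia.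
Qed.

Lemma rank1_inj x y : 0 < unbar x -> 0 < unbar y -> rank 1 x = rank 1 y -> x = y.
Proof.
move=> x0 y0; rewrite !rank1E //; case: x y x0 y0 => [b n] [b' n'] /= n0 n0'.
by case: b; case: b' => /= e; congr (_, _); lia.
Qed.

(** In the natural order the barred [n] has rank [2n - 1] and the unbarred [n] rank [2n], so even
    ranks cut by absolute value. *)
Definition upto r (s : seq elt) := [seq e <- s | rank 1 e.2 <= r].
Definition above r (s : seq elt) := [seq e <- s | r < rank 1 e.2].
Definition at_rank r (s : seq elt) := [seq e <- s | rank 1 e.2 == r].

Lemma pairwise_split (p : pred elt) s :
  pairwise (fun x y => p y ==> p x) s -> s = filter p s ++ filter (predC p) s.
Proof.
elim: s => //= x s IHs /andP[hx /IHs e].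
case px: (p x) => /=; first by rewrite {1}e.
have np : all (predC p) s.
  by apply: sub_all hx => y; rewrite /= px implybF.
have -> : filter p s = [::].
  by apply/eqP; rewrite -[_ == _]negbK -has_filter -all_predC.
by rewrite (all_filterP np).
Qed.

Section ChainFilters.
Variable s : seq elt.
Hypotheses (sP : all (fun e => 0 < unbar e.2) s) (sS : pairwise chain_lt s).

Lemma rank_sorted : pairwise (fun e e' : elt => rank 1 e.2 <= rank 1 e'.2) s.
Proof.
apply: sub_pairwise sS => e e'; rewrite /chain_lt /ltk.
by case/orP=> [/ltnW//|/andP[/eqP->]].
Qed.

Lemma chain_split r : s = upto r s ++ above r s.
Proof.
rewrite [LHS](@pairwise_split (fun e => rank 1 e.2 <= r)).
  by congr (_ ++ _); apply: eq_filter => e; rewrite /= ltnNge.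
apply: sub_pairwise rank_sorted => e e' h.
by apply/implyP; exact: leq_trans.
Qed.

Lemma upto_succ r : upto r.+1 s = upto r s ++ at_rank r.+1 s.
Proof.
rewrite [LHS](@pairwise_split (fun e => rank 1 e.2 <= r)).
  rewrite -!filter_predI; congr (_ ++ _); apply: eq_filter => e /=; clear; lia.
apply: pairwise_filter; apply: sub_pairwise rank_sorted => e e' h.
by apply/implyP; exact: leq_trans.
Qed.

Lemma above_succ r : above r s = at_rank r.+1 s ++ above r.+1 s.
Proof.
rewrite [LHS](@pairwise_split (fun e => rank 1 e.2 <= r.+1)).
  rewrite -!filter_predI; congr (_ ++ _); apply: eq_filter => e /=; clear; lia.
apply: pairwise_filter; apply: sub_pairwise rank_sorted => e e' h.
by apply/implyP; exact: leq_trans.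
Qed.

Lemma at_rank_barred k : all (fun e => e.2 == (true, k.+1)) (at_rank k.*2.+1 s).
Proof.
rewrite all_filter; apply: sub_all sP => e e0 /=; apply/implyP => /eqP re.
by apply/eqP; apply: rank1_inj => //; rewrite re rank1E //=; lia.
Qed.

Lemma at_rank_unbarred k : all (fun e => e.2 == (false, k.+1)) (at_rank k.*2.+2 s).
Proof.
rewrite all_filter; apply: sub_all sP => e e0 /=; apply/implyP => /eqP re.
by apply/eqP; apply: rank1_inj => //; rewrite re rank1E //=; lia.
Qed.

End ChainFilters.

Lemma foldl_step_unbarred st s : unb s -> foldl step st s = (st.1, st.2 ++ s).
Proof.
elim: s st => [|e s IHs] [B U] /=; first by rewrite cats0.
by case/andP=> he hs; rewrite IHs // /step (negPf he) /= cat_rcons.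
Qed.

Lemma bars_first_barred s : all (fun e => barred e.2) s -> bars_first s = (s, [::]).
Proof.
elim/last_ind: s => // s e IHs; rewrite all_rcons => /andP[he /IHs hs].
by rewrite bars_first_rcons hs /step he.
Qed.

(** If a barred [m] stands between an unbarred [n] and an unbarred [n'], then [n < m <= n'], as
    [strip_bars_first] requires. *)
Lemma chain_strip s : valid [::] (cells s) -> all (fun e => 0 < unbar e.2) s ->
  pairwise chain_lt s -> sorted strip_le (bars_first s).2.
Proof.
move=> sV sP sS; apply: strip_bars_first => //.
  move=> s1 s2 e e' es e1 e2 /negPf ue /negPf ue'.
  have /andP[e0 e0'] : (0 < unbar e.2) && (0 < unbar e'.2).
    by move: sP; rewrite es all_cat => /andP[/allP/(_ _ e1)-> /allP/(_ _ e2)->].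
  move: sS; rewrite es pairwise_cat => /andP[/allrelP/(_ _ _ e1 e2) + _].
  rewrite /chain_lt /ltk /strip_le !rank1E // ue ue' !subn0.
  by case/orP=> [h|/andP[/eqP-> ->]]; [apply/orP; left; lia | rewrite eqxx orbT].
move=> s1 b s2 e e' es hb e1 e2 /negPf ue /negPf ue'.
have /and3P[e0 b0 e0'] : [&& 0 < unbar e.2, 0 < unbar b.2 & 0 < unbar e'.2].
  move: sP; rewrite es all_cat /= => /and3P[/allP/(_ _ e1)-> -> /allP/(_ _ e2)->].
  by [].
move: sS; rewrite es pairwise_cat /= allrel_consr.
case/and4P=> /andP[/allP/(_ _ e1) h1 _] _ /allP/(_ _ e2) h2 _.
move: h1 h2; rewrite /= /chain_lt /ltk !rank1E // ue ue' hb.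
have -> : (e.2 == b.2) = false by apply/eqP=> h; rewrite h hb in ue.
have -> : (b.2 == e'.2) = false by apply/eqP=> h; rewrite h ue' in hb.
by rewrite !orbF /=; move: (unbar _) (unbar _) (unbar _) e0 b0 e0'; clear; lia.
Qed.

Lemma letters_bars_first_mem s e : e \in (bars_first s).1 ++ (bars_first s).2 ->
  e.2 \in letters s.
Proof.
have [h1 h2] := letters_bars_first s.
rewrite mem_cat => /orP[] /(map_f snd); rewrite -/(letters _) ?h1 ?h2 mem_filter;
  by case/andP.
Qed.

Lemma bars_first_barred1 s : all (fun e => barred e.2) (bars_first s).1.
Proof.
apply/allP => e /(map_f snd); have [h1 _] := letters_bars_first s.
by rewrite -/(letters _) h1 mem_filter => /andP[].
Qed.

Lemma bars_first_unb2 s : all (fun e => ~~ barred e.2) (bars_first s).2.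
Proof. exact: (@foldl_step_unb ([::], [::])). Qed.

Lemma rank1_gt0 x : 0 < unbar x -> 0 < rank 1 x.
Proof. by move=> x0; rewrite rank1E //; case: barred; lia. Qed.

Lemma rank1_le x k : 0 < unbar x -> rank 1 x <= k.*2 -> unbar x <= k.
Proof. by move=> x0; rewrite rank1E //; case: barred => /=; lia. Qed.

Lemma bars_first_cat s t : bars_first (s ++ t) = foldl step (bars_first s) t.
Proof. exact: foldl_cat. Qed.

(** Invariant of the conversion: for the order <^k the letters up to [k] are sorted bars first,
    while the larger ones are still in their natural order. *)
Lemma convk_realizes k T s :
    valid [::] (cells s) -> all (fun e => 0 < unbar e.2) s -> pairwise chain_lt s ->
    realizes T ((bars_first (upto k.+1.*2 s)).1 ++ (bars_first (upto k.+1.*2 s)).2 ++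
      above k.+1.*2 s) ->
  realizes (convk k.+1 T) ((bars_first (upto k.+2.*2 s)).1 ++
    (bars_first (upto k.+2.*2 s)).2 ++ above k.+2.*2 s).
Proof.
move=> sV sP sS; have eS := chain_split sS k.+1.*2.
have V := sV; move: V; rewrite {1}eS /cells map_cat => /valid_cat[V1 V2].
have inv2 := upto_succ sS k.+1.*2.+1; have inv1 := upto_succ sS k.+1.*2.
have ab1 := above_succ sS k.+1.*2; have ab2 := above_succ sS k.+1.*2.+1.
have hb := at_rank_barred sP k.+1; have hu := at_rank_unbarred sP k.+1.
rewrite -doubleS in inv2 ab2 hu.
set t := upto k.+1.*2 s in eS V1 V2 inv1 inv2 *.
set blk := at_rank k.+1.*2.+1 s in inv1 ab1 hb *.
have tP : all (fun e => 0 < unbar e.2) t.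
  by rewrite all_filter; apply: sub_all sP => e /= ->; rewrite implybT.
have tS : pairwise chain_lt t by apply: pairwise_filter.
have tle e : e \in (bars_first t).1 ++ (bars_first t).2 -> 0 < unbar e.2 <= k.+1.
  move/letters_bars_first_mem => /mapP[f ft ->]; have f0 := allP tP f ft.
  by rewrite f0 rank1_le //; move: ft; rewrite mem_filter => /andP[].
have tV : valid [::] (cells ((bars_first t).1 ++ (bars_first t).2 ++ above k.+1.*2 s)).
  rewrite catA /cells map_cat; apply/valid_cat; split; first exact: bars_first_valid.
  by apply: valid_eq V2 => c; rewrite !cat0s -/(cells _) -/(cells _) mem_bars_first.
have le1 : all (fun e => barred e.2 && (unbar e.2 <= k.+2)) (bars_first t).1.
  apply/allP => e et; rewrite (allP (bars_first_barred1 t)) //=.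
  by have /andP[_ /leqW] : 0 < unbar e.2 <= k.+1 by apply: tle; rewrite mem_cat et.
have le2 : all (fun e => [&& ~~ barred e.2, 0 < unbar e.2 & unbar e.2 <= k.+2])
    (bars_first t).2.
  apply/allP => e et; rewrite (allP (bars_first_unb2 t)) //=.
  have /andP[-> /leqW ->//] : 0 < unbar e.2 <= k.+1.
  by apply: tle; rewrite mem_cat et orbT.
rewrite ab1 in tV *; move=> RT.
have occ : occurrences T (true, k.+2) = cells blk.
  apply: (@occurrencesE _ ((bars_first t).1 ++ (bars_first t).2) _ (above k.+1.*2.+1 s)).
  - by rewrite -catA; exact: valid_uniq tV.
  - by rewrite -catA.
  - apply/allP => e /tle /andP[_ ek]; apply/eqP => ee; rewrite ee in ek.
    by rewrite /= ltnn in ek.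
  - apply/allP => e; rewrite mem_filter => /andP[lt _]; apply/eqP => ee.
    by move: lt; rewrite ee rank1E //=; lia.
  - exact: hb.
  - have : pairwise chain_lt blk by apply: pairwise_filter.
    apply: (sub_in_pairwise (P := mem blk)); last exact/allP.
    move=> e e' /(allP hb) /eqP he /(allP hb) /eqP he'.
    by rewrite /chain_lt he he' /ltk ltnn eqxx /= => /andP[].
have := foldl_slide_realizes tV le1 le2 hb (chain_strip V1 tP tS) RT.
rewrite /convk occ -surjective_pairing -bars_first_cat -inv1 ab2 inv2.
(* The unbarred letters [k + 2] come next and join the unbarred part without any interchange. *)
rewrite bars_first_cat foldl_step_unbarred /= ?catA //.
by apply: sub_all hu => e /eqP->.
Qed.

Lemma upto0 s : all (fun e => 0 < unbar e.2) s -> upto 0 s = [::].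
Proof.
elim: s => //= e s IHs /andP[e0 /IHs].
by rewrite /upto /= leqNgt rank1_gt0.
Qed.

Lemma foldl_convk_realizes T s k : chain_of T s ->
  realizes (foldl (fun U k => convk k U) T (iota 1 k))
    ((bars_first (upto k.+1.*2 s)).1 ++ (bars_first (upto k.+1.*2 s)).2 ++
      above k.+1.*2 s).
Proof.
case=> RT sV sP sS; elim: k => [|k IHk]; last first.
  by rewrite -[in iota 1 _](addn1 k) iotaD foldl_cat /= add1n; exact: convk_realizes.
(* The barred letters 1 precede the unbarred letters 1 already in the natural order. *)
suff e : bars_first (upto 1.*2 s) = (upto 1 s, at_rank 2 s).
  by rewrite e /= catA -upto_succ // -chain_split.
have hb := at_rank_barred sP 0; have hu := at_rank_unbarred sP 0.
rewrite (upto_succ sS 1) bars_first_cat bars_first_barred.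
  rewrite foldl_step_unbarred //=.
  by apply: sub_all hu => e /eqP->.
rewrite upto_succ // upto0 //.
by apply: sub_all hb => e /eqP->.
Qed.

Lemma conv_realizes T s : chain_of T s ->
  realizes (conv T) ((bars_first s).1 ++ (bars_first s).2).
Proof.
move=> cT; have := foldl_convk_realizes (max_letter T) cT.
have [RT sV sP sS] := cT.
have le e : e \in s -> unbar e.2 <= max_letter T.
  move=> es; rewrite -(RT.2 e es) /max_letter.
  apply: (leq_bigmax_seq (F := unbar)) => //; apply/flattenP.
  have eD : in_diagram T e.1 by rewrite RT.1; exact: map_f.
  exists (nth [::] T e.1.1); last exact: mem_nth.
  apply: mem_nth; rewrite ltnNge; apply/negP=> h.
  by move: eD; rewrite /in_diagram nth_default.
have -> : above (max_letter T).+1.*2 s = [::].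
  rewrite /above (eq_in_filter (a2 := pred0)) ?filter_pred0 // => e es /=.
  apply/negbTE; rewrite -leqNgt rank1E ?(allP sP) //; have := le e es.
  by move: (unbar e.2) (max_letter T); clear; lia.
have -> : upto (max_letter T).+1.*2 s = s.
  apply/all_filterP/allP => e es.
  rewrite rank1E ?(allP sP) //; have := le e es.
  by move: (unbar e.2) (max_letter T); clear; lia.
by rewrite cats0.
Qed.

(** * Reading words of fillings and of chains *)

Lemma flatten_rows_extend (A : Type) (g : nat -> seq A) m n :
  (forall i, m <= i -> g i = [::]) -> m <= n ->
  flatten [seq g i | i <- rev (iota 0 n)] = flatten [seq g i | i <- rev (iota 0 m)].
Proof.
move=> g0 mn; rewrite -(subnKC mn) iotaD rev_cat map_cat flatten_cat add0n.
suff -> : flatten [seq g i | i <- rev (iota m (n - m))] = [::] by [].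
elim: (n - m) => // k IHk.
by rewrite -(addn1 k) iotaD rev_cat map_cat flatten_cat IHk /= g0 // leq_addr.
Qed.

(** Reconciles words of fillings, which run over the actual rows, with words of chains, which run up
    to a common bound. *)
Lemma eq_flatten_rows (A : Type) (g : nat -> seq A) m n :
  (forall i, m <= i -> g i = [::]) -> (forall i, n <= i -> g i = [::]) ->
  flatten [seq g i | i <- rev (iota 0 m)] = flatten [seq g i | i <- rev (iota 0 n)].
Proof.
move=> hm hn; case: (leqP m n) => [mn|/ltnW nm].
  by rewrite (flatten_rows_extend hm mn).
by rewrite (flatten_rows_extend hn nm).
Qed.

Lemma mem_lookup U c : c \in cells U -> (c, lookup U c) \in U.
Proof.
move=> cU; rewrite nth_lookup //; apply: mem_nth.
by rewrite -(size_map fst) index_mem.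
Qed.

(** Applied to the barred letters of a converted row, so that filtering keeps their columns. *)
Lemma filter_prefix (A : Type) (x0 : A) (p : pred A) r :
    (forall j k, j < k < size r -> p (nth x0 r k) -> p (nth x0 r j)) ->
  (forall j, (j < size (filter p r)) = (j < size r) && p (nth x0 r j)) /\
  (forall j, j < size (filter p r) -> nth x0 (filter p r) j = nth x0 r j).
Proof.
elim: r => [|x r IHr] h /=; first by split=> j; rewrite ?ltn0.
have [|h1 h2] := IHr; first by move=> j k jk; apply: (h j.+1 k.+1); exact: jk.
case px: (p x) => /=; first by split=> [[|j]|[|j]] //=; [exact: h1 | exact: h2].
have np j : j < size r -> p (nth x0 r j) = false.
  move=> jr; apply/negP=> pj; have := h 0 j.+1; rewrite /= ltnS jr => /(_ isT pj).
  by rewrite px.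
have -> : filter p r = [::].
  apply/nilP; rewrite /nilp -leqn0 leqNgt; apply/negP=> h0.
  by move: (h1 0); rewrite h0 => /esym/andP[/np->].
by split=> [[|j]|j] //=; rewrite ltn0 ?px // ltnS; case: ltnP => // /np ->.
Qed.

Lemma row_diagram (T : filling) i j : (j < size (nth [::] T i)) = in_diagram T (i, j).
Proof. by []. Qed.

Lemma unbarred_word T B U n :
    realizes T (B ++ U) -> all (fun e => barred e.2) B -> unb U ->
    bounded n (cells (B ++ U)) ->
  rowword (remove_bars (sub_unbarred T)) = rword n U.
Proof.
move=> RT hB hU bn.
have ET c x : (c, x) \in B ++ U -> entry dflt T c = x by exact: (RT.2 (c, x)).
have cU i j : ((i, j) \in cells U) = in_diagram T (i, j) && ~~ barred (entry dflt T (i, j)).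
  apply/idP/andP => [cU|[]].
    rewrite RT.1 /cells map_cat mem_cat orbC cU; split=> //.
    have /mem_lookup m := cU; rewrite (ET _ (lookup U (i, j))) ?(allP hU _ m) //.
    by rewrite mem_cat m orbT.
  rewrite RT.1 => /mapP[e eBU ->]; rewrite RT.2 // => ue; apply: map_f.
  by move: eBU; rewrite mem_cat => /orP[/(allP hB)|//]; rewrite (negPf ue).
have bnd c : in_diagram T c -> (c.1 < n) && (c.2 < n) by rewrite RT.1 => /(allP bn).
have row i : map unbar [seq x <- nth [::] T i | ~~ barred x] = rrow n U i.
  rewrite /rrow; have sn : size (nth [::] T i) <= n.
    rewrite leqNgt; apply/negP=> h; have := bnd (i, n) h.
    by rewrite /= ltnn andbF.
  rewrite -(subnKC sn) iotaD filter_cat map_cat add0n.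
  rewrite [X in _ = _ ++ X](_ : _ = [::]); last first.
    rewrite (eq_in_filter (a2 := pred0)) ?filter_pred0 // => j.
    by rewrite mem_iota cU -row_diagram => /andP[/leq_gtF ->].
  rewrite cats0 -{1}[nth [::] T i](mkseq_nth dflt) /mkseq filter_map -map_comp.
  rewrite [in RHS](eq_in_filter (a2 := fun j => ~~ barred (entry dflt T (i, j)))).
    apply/eq_in_map => j; rewrite mem_filter mem_iota add0n => /and3P[uj _ jr] /=.
    have /mem_lookup m : (i, j) \in cells U by rewrite cU -row_diagram jr.
    by rewrite -(ET (i, j) (lookup U (i, j))) // mem_cat m orbT.
  by move=> j; rewrite mem_iota add0n cU -row_diagram => /andP[_ ->].
rewrite /rowword /remove_bars /sub_unbarred -map_comp -[T in map _ T](mkseq_nth [::]).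
rewrite /mkseq -map_comp -map_rev (eq_map (g := rrow n U)); last by move=> i; exact: row.
rewrite /rword; apply: (@eq_flatten_rows _ (rrow n U)) => i hi; rewrite -row.
  by rewrite nth_default.
case e: (nth [::] T i) => [|x r] //; have := bnd (i, 0).
by rewrite -row_diagram e /= (ltnNge i) hi => /(_ isT).
Qed.

Lemma barred_word T B U n :
    realizes T (B ++ U) -> all (fun e => barred e.2) B -> unb U ->
    valid [::] (cells (B ++ U)) -> bounded n (cells (B ++ U)) ->
  rowword (remove_bars (transpose dflt (sub_barred T))) = rword n (flips B).
Proof.
move=> RT hB hU V bn.
(* The barred cells form a Young diagram, so they are at the beginning of their rows. *)
have dB : down (cells B).
  by move: V; rewrite /cells map_cat => /valid_cat[/(down_valid down_nil)].
have ET c x : (c, x) \in B ++ U -> entry dflt T c = x by exact: (RT.2 (c, x)).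
have cB i j : ((i, j) \in cells B) = in_diagram T (i, j) && barred (entry dflt T (i, j)).
  apply/idP/andP => [cB|[]].
    rewrite RT.1 /cells map_cat mem_cat cB; split=> //.
    have /mem_lookup m := cB; rewrite (ET _ (lookup B (i, j))) ?(allP hB _ m) //.
    by rewrite mem_cat m.
  rewrite RT.1 => /mapP[e eBU ->]; rewrite RT.2 // => ue; apply: map_f.
  by move: eBU; rewrite mem_cat orbC => /orP[/(allP hU)|//]; rewrite ue.
have cF i j : ((j, i) \in cells (flips B)) = ((i, j) \in cells B).
  rewrite cells_flips -(mem_map (f := fun d : cell => (d.2, d.1)) _ _ (i, j)) //.
  by move=> [? ?] [? ?] [-> ->].
have bnd c : c \in cells B -> (c.1 < n) && (c.2 < n).
  by move=> h; apply: (allP bn); rewrite /cells map_cat mem_cat h.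
have pre i := @filter_prefix _ dflt barred (nth [::] T i).
have {}pre i :
    (forall j, (j < size (filter barred (nth [::] T i))) = ((i, j) \in cells B)) /\
    (forall j, (i, j) \in cells B ->
       nth dflt (filter barred (nth [::] T i)) j = entry dflt T (i, j)).
  have [|h1 h2] := pre i.
    move=> j k /andP[jk kr] bk.
    have : (i, j) \in cells B.
      by apply: (dB _ (i, k)); rewrite ?cB -?row_diagram ?kr // /lec /= leqnn ltnW.
    by rewrite cB => /andP[].
  have h3 j : (j < size (filter barred (nth [::] T i))) = ((i, j) \in cells B).
    by rewrite h1 cB.
  by split=> // j; rewrite -h3; exact: h2.
have row j : map unbar [seq nth dflt r j | r <- sub_barred T & j < size r] =
    rrow n (flips B) j.
  have eT : T = [seq nth [::] T i | i <- iota 0 (size T)].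
    by rewrite -[LHS](mkseq_nth [::]).
  rewrite /rrow /sub_barred {1}eT.
  rewrite !filter_map -!map_comp.
  pose a i := (i, j) \in cells B.
  rewrite [in LHS](eq_filter (a2 := a)); last by move=> i; rewrite /= (pre i).1.
  rewrite [in RHS](eq_filter (a2 := a)); last by move=> i; rewrite cF.
  have -> : [seq i <- iota 0 (size T) | a i] = [seq i <- iota 0 n | a i].
    apply: (irr_sorted_eq ltn_trans ltnn); rewrite ?(sorted_filter ltn_trans) ?iota_ltn_sorted //.
    move=> i; rewrite !mem_filter !mem_iota !add0n !leq0n /=.
    case ai: (a i) => //=; have /andP[/= -> _] := bnd _ ai.
    rewrite ltnNge; apply/negP=> h; move: ai.
    by rewrite /a cB -row_diagram nth_default.
  apply/eq_in_map => i; rewrite mem_filter => /andP[ai _] /=.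
  rewrite (pre i).2 //.
  have /mem_lookup m : (j, i) \in cells (flips B) by rewrite cF.
  have /mapP[e eB ee] := m.
  have ec : e.1 = (i, j) by move: ee; case: (e) => [[? ?] [? ?]] [-> ->].
  rewrite -ec RT.2 ?mem_cat ?eB //.
  by move/(congr1 (fun x : elt => unbar x.2)): ee => /= ->.
rewrite /rowword /remove_bars /transpose /mkseq -map_comp -map_rev.
rewrite (eq_map (g := rrow n (flips B))); last by move=> j; exact: row.
rewrite /rword; apply: (@eq_flatten_rows _ (rrow n (flips B))) => j hj.
  rewrite rrow_nil // => i; rewrite cF; apply/negP=> ij.
  (* [transpose] takes the number of columns from the top row; a nonempty column of the diagram
     reaches that row. *)
  have : (0, j) \in cells B by apply: dB ij; rewrite /lec /=.
  rewrite -(pre 0).1; apply/negP; rewrite -leqNgt.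
  by move: hj; rewrite /sub_barred; case: (T) => [|r T'].
rewrite rrow_nil // => i; rewrite cF; apply/negP=> /bnd /=.
by rewrite (ltnNge j) hj andbF.
Qed.

(** * The chain of a colored tableau *)

(** Equal barred letters form a vertical strip, which transposes to a horizontal one. An unbarred
    [p] between a barred [m] and a barred [m'] gives [m <= p < m']. *)
Lemma chain_strip_flips s : valid [::] (cells s) -> all (fun e => 0 < unbar e.2) s ->
  pairwise chain_lt s -> sorted strip_le (bars_first (flips s)).2.
Proof.
move=> sV sP sS; apply: strip_bars_first; first exact: valid_flips.
  move=> s1 s2 e e' /(congr1 flips); rewrite flipsK flips_cat => es e1 e2 ue ue'.
  have {}e1 : flip e \in flips s1 by exact: map_f.
  have {}e2 : flip e' \in flips s2 by exact: map_f.
  have /andP[e0 e0'] : (0 < unbar e.2) && (0 < unbar e'.2).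
    by move: sP; rewrite es all_cat => /andP[/allP/(_ _ e1)-> /allP/(_ _ e2)->].
  move: sS; rewrite es pairwise_cat => /andP[/allrelP/(_ _ _ e1 e2) + _].
  case: e e' ue ue' e0 e0' {e1 e2} => [c [[] m]] [c' [[] m']] //= _ _ m0 m0'.
  rewrite /chain_lt /ltk /strip_le !rank1E //= ?xpair_eqE /=.
  by case/orP=> [h|/andP[/eqP-> ->]]; [apply/orP; left; lia | rewrite eqxx orbT].
move=> s1 b s2 e e' /(congr1 flips); rewrite flipsK flips_cat /= => es hb e1 e2 ue ue'.
have {}e1 : flip e \in flips s1 by exact: map_f.
have {}e2 : flip e' \in flips s2 by exact: map_f.
have /and3P[e0 b0 e0'] : [&& 0 < unbar e.2, 0 < unbar b.2 & 0 < unbar e'.2].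
  by move: sP; rewrite es all_cat /= => /and3P[/allP/(_ _ e1)-> -> /allP/(_ _ e2)->].
move: sS; rewrite es pairwise_cat /= allrel_consr.
case/and4P=> /andP[/allP/(_ _ e1) h1 _] _ /allP/(_ _ e2) h2 _.
move: h1 h2; case: e b e' ue hb ue' e0 b0 e0' {e1 e2 es} 
  => [c [[] m]] [d [[] p]] [c' [[] m']] //= _ _ _ m0 p0 m0'.
by rewrite /chain_lt /ltk !rank1E //= ?xpair_eqE /= ?orbF; lia.
Qed.

Section ChainExists.
Variable T : filling.
Hypothesis TC : colored_tableau natural_le T.

Lemma row_size_anti i i' : i <= i' -> size (nth [::] T i') <= size (nth [::] T i).
Proof.
have /andP[sT _] := ct_straight TC.
have geT : transitive geq by move=> x y z /= ? ?; lia.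
have sz k : size (nth [::] T k) = nth 0 (shape T) k.
  have [lt|ge] := ltnP k (size T); first by rewrite (nth_map [::]).
  by rewrite !nth_default // size_map.
rewrite !sz leq_eqVlt => /predU1P[->//|ii'].
have [lt|ge] := ltnP i' (size (shape T)); last by rewrite nth_default.
move: sT; rewrite (sorted_pairwise geT) => /(pairwiseP 0).
by apply; rewrite // inE (ltn_trans ii').
Qed.

Lemma in_diagram_down c d : lec c d -> in_diagram T d -> in_diagram T c.
Proof.
by rewrite /in_diagram => /andP[h1 h2] h3; have := row_size_anti h1; lia.
Qed.

Local Notation val := (entry dflt T).

Lemma rank_lec c d : lec c d -> in_diagram T d -> rank 1 (val c) <= rank 1 (val d).
Proof.
case: c d => [i j] [i' j'] cd dD; have /andP[/= ii jj] := cd.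
have mD : in_diagram T (i', j) by apply: in_diagram_down dD; rewrite /lec /= leqnn.
have cD := in_diagram_down cd dD.
have pos e : in_diagram T e -> 0 < unbar (val e) by move=> eD; exact: (ct_alphabet TC eD).
have h1 : rank 1 (val (i, j)) <= rank 1 (val (i', j)).
  move: ii; rewrite leq_eqVlt => /predU1P[->//|ii].
  by have := ct_col TC ii mD; rewrite -lek1E ?pos.
apply: leq_trans h1 _.
move: jj; rewrite leq_eqVlt => /predU1P[->//|jj].
by have := ct_row TC jj dD; rewrite -lek1E ?pos.
Qed.

(** The cell in the column of [c] and the row of [d] is squeezed between the two and has the same
    letter, so a repetition in a row or in a column would result. *)
Lemma equal_letters c d : lec c d -> c != d -> in_diagram T d -> val c = val d ->
  if barred (val d) then c.2 = d.2 else c.1 = d.1.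
Proof.
case: c d => [i j] [i' j'] cd ncd dD e; have /andP[/= ii jj] := cd.
have mD : in_diagram T (i', j) by apply: in_diagram_down dD; rewrite /lec /= leqnn.
have cD := in_diagram_down cd dD.
have pos e' : in_diagram T e' -> 0 < unbar (val e') by move=> eD; exact: (ct_alphabet TC eD).
have m : val (i', j) = val (i', j').
  apply: rank1_inj; rewrite ?pos //; apply/eqP; rewrite eqn_leq.
  by rewrite rank_lec /lec /= ?leqnn // -e rank_lec // /lec /= leqnn ii.
case hb: barred.
  move: jj; rewrite leq_eqVlt => /predU1P[//|jj].
  by have := ct_row_barred TC jj dD hb m.
move: ii; rewrite leq_eqVlt => /predU1P[//|ii].
have := ct_col_unbarred TC ii mD; rewrite m hb => /(_ isT).
by rewrite e.
Qed.

Let tie c := if barred (val c) then c.1 else c.2.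

Let cell_le c d :=
  (rank 1 (val c) < rank 1 (val d)) ||
  (rank 1 (val c) == rank 1 (val d)) && (tie c <= tie d).

Lemma cell_le_trans : transitive cell_le.
Proof. by move=> c d e; rewrite /cell_le; lia. Qed.

Lemma cell_le_total : total cell_le.
Proof. by move=> c d; rewrite /cell_le; lia. Qed.

Lemma cell_le_lec c d : lec c d -> c != d -> in_diagram T d -> ~~ cell_le d c.
Proof.
move=> cd ncd dD; have cD := in_diagram_down cd dD.
have := rank_lec cd dD; rewrite leq_eqVlt => /predU1P[e|]; last by rewrite /cell_le; lia.
rewrite /cell_le.
have ev : val c = val d.
  by apply: rank1_inj e; [exact: (ct_alphabet TC cD) | exact: (ct_alphabet TC dD)].
have := equal_letters cd ncd dD ev; rewrite /tie ev ltnn eqxx /= -ltnNge.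
by case: c d cd ncd {e ev cD dD} => [i j] [i' j'];
  rewrite /lec xpair_eqE /=; case: barred; lia.
Qed.

(** [tie] compares one coordinate only; the inequality for the other one comes from
    [equal_letters]. *)
Lemma cell_le_chain_lt c d : in_diagram T c -> in_diagram T d -> c != d ->
  cell_le c d -> chain_lt (c, val c) (d, val d).
Proof.
move=> cD dD ncd; rewrite /cell_le /chain_lt /ltk /= => /orP[->//|/andP[/eqP e]].
have ev : val c = val d.
  by apply: rank1_inj e; [exact: (ct_alphabet TC cD) | exact: (ct_alphabet TC dD)].
rewrite /tie ev ltnn eqxx /=.
have h1 : lec c d -> if barred (val d) then c.2 = d.2 else c.1 = d.1.
  by move=> cd; exact: equal_letters.
have h2 : lec d c -> if barred (val d) then d.2 = c.2 else d.1 = c.1.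
  by move=> dc; rewrite -ev; apply: equal_letters; rewrite // eq_sym.
move: h1 h2; case: c d ncd {cD dD e ev} => [i j] [i' j'];
  rewrite /lec xpair_eqE /=; case: barred; lia.
Qed.

Lemma valid_intro D s :
  (forall s1 c s2, s = s1 ++ c :: s2 -> addable (D ++ s1) c) -> valid D s.
Proof.
elim: s D => //= c s IHs D h; split; first by have := h [::] c s erefl; rewrite cats0.
by apply: IHs => s1 d s2 e; rewrite cat_rcons; apply: (h (c :: s1) d s2); rewrite e.
Qed.

Lemma chain_exists : exists s, chain_of T s.
Proof.
pose cs0 := [seq (i, j) | i <- iota 0 (size T), j <- iota 0 (size (nth [::] T i))].
pose cs := sort cell_le cs0.
have uq : uniq cs.
  rewrite sort_uniq; apply: allpairs_uniq_dep; rewrite ?iota_uniq //.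
    by move=> i _; rewrite iota_uniq.
  by move=> [i j] [i' j'] _ _ [-> ->].
have mcs c : (c \in cs) = in_diagram T c.
  rewrite mem_sort; apply/allpairsPdep/idP => [[i [j [_ + ->]]]|cD].
    by rewrite mem_iota.
  exists c.1, c.2; rewrite !mem_iota -surjective_pairing; split=> //=.
  by rewrite ltnNge; apply/negP=> h; move: cD; rewrite /in_diagram nth_default.
have srt : pairwise cell_le cs.
  by rewrite -(sorted_pairwise cell_le_trans) sort_sorted //; exact: cell_le_total.
exists [seq (c, val c) | c <- cs].
have ec : cells [seq (c, val c) | c <- cs] = cs.
  by rewrite /cells -map_comp map_id_in.
split.
- split=> [c|e]; first by rewrite ec mcs.
  by case/mapP=> c _ ->.
- rewrite ec; apply: valid_intro => s1 c s2 es; rewrite cat0s; split.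
    by move: uq; rewrite es cat_uniq /= => /and3P[_ /norP[]].
  move=> d dc nd; have cD : in_diagram T c by rewrite -mcs es mem_cat mem_head orbT.
  have : d \in cs by rewrite mcs; exact: in_diagram_down cD.
  rewrite es mem_cat inE (negPf nd) /= => /orP[//|d2].
  have := cell_le_lec dc nd cD.
  by move: srt; rewrite es pairwise_cat /= => /and4P[_ _ /allP/(_ _ d2) -> _].
- by rewrite all_map; apply/allP => c; rewrite mcs => cD; exact: (ct_alphabet TC cD).
- rewrite pairwise_map; have := uq; rewrite uniq_pairwise => uq'.
  have : pairwise (fun c d => (c != d) && cell_le c d) cs.
    by rewrite pairwise_relI uq' srt.
  apply: (sub_in_pairwise (P := mem cs)); last exact/allP.
  move=> c d; rewrite !mcs => cD dD /andP[ncd]; exact: cell_le_chain_lt.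
Qed.

End ChainExists.

Lemma southwest_diagram (T : filling) : straight T -> 0 < size T ->
  in_diagram T ((size T).-1, 0).
Proof.
case/andP=> _ n0 T0; rewrite /in_diagram /= lt0n; apply: contraNneq n0 => e.
by apply/(nthP 0); exists (size T).-1; rewrite ?size_map ?(nth_map [::]) //; lia.
Qed.

Lemma in_diagram_size (T : filling) c : in_diagram T c -> c.1 < size T.
Proof.
by rewrite ltnNge => cD; apply/negP=> h; move: cD; rewrite /in_diagram nth_default.
Qed.

(** The southwest letter is the last barred [a] of the chain, and every unbarred [a] is to its
    right. Without its bar it becomes the first unbarred [a], so its place in the chain remains
    correct. *)
Lemma chain_C_minus (T : filling) s1 s2 a : 0 < size T ->
    let sw := ((size T).-1, 0) in
    chain_of T (s1 ++ (sw, (true, a)) :: s2) ->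
  chain_of (C_minus T) (s1 ++ (sw, (false, a)) :: s2) /\
  {in s2, forall e, ltk 1 (true, a) e.2}.
Proof.
move=> T0 sw [RT V P S].
have uq := valid_uniq V.
have ec : cells (s1 ++ (sw, (true, a)) :: s2) = cells (s1 ++ (sw, (false, a)) :: s2).
  by rewrite /cells !map_cat.
have swT : entry dflt T sw = (true, a).
  by apply: (RT.2 (sw, _)); rewrite mem_cat mem_head orbT.
have swD : in_diagram T sw by rewrite RT.1 /cells map_cat mem_cat mem_head orbT.
have eT e : e \in s1 ++ (sw, (true, a)) :: s2 -> e.1.1 < size T.
  by move=> es; apply: in_diagram_size; rewrite RT.1; exact: map_f.
have [sw1 sw2] : sw \notin cells s1 /\ sw \notin cells s2.
  move: uq; rewrite /cells map_cat cat_uniq /= => /and3P[_ /norP[-> _] /andP[-> _]].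
  by [].
have a0 : 0 < a by move: P; rewrite all_cat /= => /and3P[].
move: (S); rewrite pairwise_cat /= allrel_consr => /and4P[/andP[L1 L2] S1 S2 S3].
(* A later barred [a] would lie in a row below the last one. *)
have gt e : e \in s2 -> ltk 1 (true, a) e.2.
  move=> es; have := allP S2 e es; rewrite /chain_lt /= => /orP[//|/and3P[_ h _]].
  have := eT e; rewrite mem_cat inE es !orbT => /(_ isT).
  by move: h; rewrite /sw /= => h; rewrite -{1}(prednK T0) ltnS leqNgt h.
split=> //; split.
- split=> [c|e].
    rewrite /C_minus in_diagram_set // RT.1 ec //.
  rewrite /C_minus entry_set /southwest -/sw swT mem_cat inE.
  have other : e \in s1 \/ e \in s2 -> e.1 != sw.
    by case=> es; apply/eqP => e1; [move: sw1 | move: sw2]; rewrite -e1 map_f.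
  case/or3P=> [es|/eqP->|es]; last 1 first.
  + by rewrite (negPf (other _)) ?RT.2 ?mem_cat ?inE ?es ?orbT //; right.
  + by rewrite (negPf (other _)) ?RT.2 ?mem_cat ?inE ?es ?orbT //; left.
  + by rewrite eqxx.
- by rewrite -ec.
- by move: P; rewrite !all_cat.
- rewrite pairwise_cat /= allrel_consr S1 S3 L2 !andbT /=; apply/andP; split.
    have P1 : all (fun e => 0 < unbar e.2) s1 by move: P; rewrite all_cat => /andP[].
    apply/allP => e es; have := allP L1 e es; have e0 := allP P1 e es.
    rewrite /chain_lt /ltk /= => h; apply/orP; left; move: h.
    rewrite !rank1E //=; case/orP=> [|/andP[/eqP-> _] /=]; move: a0; clear; first by lia.
    by lia.
  apply/allP => e es; have := gt e es; rewrite /chain_lt /ltk /=.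
  have P2 : all (fun e => 0 < unbar e.2) s2 by move: P; rewrite all_cat /= => /and3P[].
  have e0 := allP P2 e es; rewrite !rank1E //=.
  have ea : e.1.1 <= (size T).-1.
    by rewrite -ltnS prednK //; apply: eT; rewrite mem_cat inE es !orbT.
  case ee: e.2 e0 => [b m] /= e0.
  (* The other cells of the first column are above [sw], so they come earlier in the chain. *)
  have col : 0 < e.1.2.
    rewrite lt0n; apply/eqP => e2.
    have le : lec e.1 sw by rewrite /lec e2 /= ea.
    have nsw : e.1 != sw by apply/eqP => e1; move: sw2; rewrite -e1 map_f.
    move: V; rewrite /cells map_cat => /valid_cat[_ [[_ h] _]].
    move: uq; rewrite /cells map_cat cat_uniq => /and3P[_ /hasPn h' _].
    have := h' e.1; rewrite /= inE map_f ?orbT //= => /(_ isT).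
    by have /= -> := h e.1 le nsw.
  rewrite xpair_eqE ea col !andbT; move: a0 e0; clear; case: b => /=; last by lia.
  by lia.
Qed.

(** * Toggling the southwest bar *)

Lemma addable_weaken D D' c : {subset D <= D'} -> c \notin D' ->
  addable D c -> addable D' c.
Proof. by move=> DD' cD' [_ h]; split=> // d dc nd; apply: DD'; exact: h. Qed.

Lemma valid_weaken D D' s : {subset D <= D'} -> {in s, forall c, c \notin D'} ->
  valid D s -> valid D' s.
Proof.
elim: s D D' => //= c s IHs D D' DD' n [cD sV]; split.
  by apply: addable_weaken cD => //; exact: n (mem_head _ _).
have cs := valid_notin sV; apply: (IHs (rcons D c)) => //.
  by move=> d; rewrite !in_rcons => /predU1P[->|/DD'->]; rewrite ?eqxx ?orbT.
move=> d ds; rewrite in_rcons negb_or n ?inE ?ds ?orbT // andbT.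
by have := cs d ds; rewrite in_rcons negb_or => /andP[].
Qed.

Lemma valid_insert s1 z s2 : valid [::] (s1 ++ s2) -> addable s1 z ->
  z \notin s2 -> valid [::] (s1 ++ z :: s2).
Proof.
move=> /valid_cat[V1 V2] za zs; have n2 := valid_notin V2; apply/valid_cat; split=> //; split=> //.
apply: valid_weaken V2 => [d|d ds].
  by rewrite in_rcons => ->; rewrite orbT.
have dz : d != z by apply: contraNneq zs => <-.
rewrite in_rcons negb_or dz /=.
exact: n2.
Qed.

Lemma letters_cat s t : letters (s ++ t) = letters s ++ letters t.
Proof. exact: map_cat. Qed.

Lemma blft_word_chain n T s : chain_of T s -> bounded n (cells s) ->
  blft_word T = rword n (flips (bars_first s).1) ++ rword n (bars_first s).2.
Proof.
move=> cT bn; have RT := conv_realizes cT; have V := bars_first_valid (chain_valid cT).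
have hB := bars_first_barred1 s; have hU := bars_first_unb2 s.
have bn' : bounded n (cells ((bars_first s).1 ++ (bars_first s).2)).
  by rewrite /bounded (eq_all_r (mem_bars_first s)).
by rewrite /blft_word (barred_word RT hB hU V bn') (unbarred_word RT hB hU bn').
Qed.

Lemma exists_bound (s : seq cell) l : exists2 n, l < n & bounded n s.
Proof.
elim: s => [|c s [n ln sn]]; first by exists l.+1.
exists (n + c.1.+1 + c.2.+1); first by lia.
rewrite /bounded /=; apply/andP; split; first by lia.
by apply: sub_all sn => d; lia.
Qed.

Lemma letters_flips_bars_first s :
  letters (flips (bars_first s).1) = letters (bars_first (flips s)).2.
Proof.
have e t : letters (flips t) = [seq (~~ x.1, x.2) | x <- letters t].
  by rewrite /letters /flips -!map_comp.
rewrite e (letters_bars_first s).1 (letters_bars_first _).2 e [RHS]filter_map.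
by congr (map _ _); apply: eq_filter => x; rewrite /= /barred negbK.
Qed.

Section Toggle.
Variables (s1 s2 : seq elt) (a r : nat).
Let sw : cell := (r, 0).
Let z : cell := (r.+1, 0).
Let barredT := s1 ++ (sw, (true, a)) :: s2.
Let unbarredT := s1 ++ (sw, (false, a)) :: s2.
(* [X] and [Y] add to the chains of [C_minus T] and [T] one letter in the cell
   [z] below the southwest one; they differ by a single interchange. *)
Let X := s1 ++ [:: (sw, (false, a)), (z, (true, a)) & s2].
Let Y := s1 ++ [:: (sw, (true, a)), (z, (false, a)) & s2].
Hypothesis validT : valid [::] (cells unbarredT).
Hypothesis rows : {in cells unbarredT, forall c, c.1 <= r}.

Let eqXY : bars_first X = bars_first Y.
Proof.
rewrite /X bars_first_swp //; congr bars_first.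
by rewrite /swp /adj /= eqxx !orbT.
Qed.

Let zN : z \notin cells unbarredT.
Proof. by apply/negP=> /rows; rewrite /= ltnn. Qed.

Let validX : valid [::] (cells X).
Proof.
move: validT; rewrite /unbarredT /X /cells !map_cat /= -!(cat_rcons sw) => V.
apply: valid_insert => //.
  have dD : down (rcons (cells s1) sw).
    by move: V => /valid_cat[/(down_valid down_nil)].
  split.
    apply: contra zN; rewrite /cells /unbarredT map_cat mem_cat inE in_rcons.
    by case/orP=> ->; rewrite ?orbT.
  move=> [i j]; rewrite /lec /= leqn0 => /andP[ir /eqP->] ne.
  apply: (dD _ sw); last by rewrite in_rcons eqxx.
  by rewrite /lec /= andbT; move: ne ir; rewrite /z xpair_eqE; clear; lia.
by apply: contra zN => h; rewrite /cells /unbarredT map_cat mem_cat inE h !orbT.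
Qed.

(** The only neighbor of [z] in the diagram is [sw], which is not among the later cells. *)
Let adjN : {in cells s2, forall c, ~~ adj z c}.
Proof.
move=> c cs; have cr : c.1 <= r.
  by apply: rows; rewrite /cells /unbarredT map_cat mem_cat inE cs !orbT.
have nsw : c != sw.
  have := valid_uniq validT; rewrite /unbarredT /cells map_cat cat_uniq /=.
  by case/and4P=> _ _ h _; apply: contraNneq h => <-.
by move: c cr nsw {cs} => [i j]; rewrite /adj /sw xpair_eqE /=; clear; lia.
Qed.

Let cells_rows s : {subset cells s <= cells unbarredT} ->
  forall c, c \in cells s -> c.1 < r.+1.
Proof. by move=> sub c /sub /rows; rewrite ltnS. Qed.

Let cellsT : cells barredT = cells unbarredT.
Proof. by rewrite /cells !map_cat. Qed.

Let boundC n : bounded n (cells X) -> bounded n (cells unbarredT).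
Proof.
move=> bn; apply/allP => c cC; apply: (allP bn); move: cC.
by rewrite /cells !map_cat !mem_cat /= !inE => /or3P[] ->; rewrite ?orbT.
Qed.

(* Common to both parts: the barred letter in the cell [z] of [X], and the
   unbarred one of [Y], are never moved. *)
Lemma inert_cell :
  (exists B U1 U2, bars_first barredT = (B, U1 ++ U2) /\
     bars_first Y = (B, U1 ++ (z, (false, a)) :: U2)) /\
  (exists R K1 K2, [/\ letters K1 = [seq x <- letters (flips s1) | ~~ barred x],
     bars_first (flips unbarredT) = (R, K1 ++ K2) &
     bars_first (flips X) = (R, K1 ++ flip (z, (true, a)) :: K2)]).
Proof.
split.
  have [//|//|B [U1 [U2 [_ eT eY]]]] :=
    @bars_first_insert (rcons s1 (sw, (true, a))) (z, (false, a)) s2.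
  by exists B, U1, U2; rewrite -eT -eY !cat_rcons.
have [//||R [K1 [K2 [eK eC eX]]]] :=
  @bars_first_insert (flips (rcons s1 (sw, (false, a)))) (flip (z, (true, a))) (flips s2).
  move=> c; rewrite cells_flips => /mapP[d /adjN nd ->].
  by move: nd; case: (d) => ? ?; rewrite /adj /= orbC.
exists R, K1, K2; rewrite -eC -eX eK; split.
- by rewrite (letters_bars_first _).2 -cats1 flips_cat letters_cat filter_cat /= cats0.
- by rewrite /unbarredT -cat_rcons flips_cat.
- by rewrite /X -(cat_rcons (sw, (false, a))) flips_cat.
Qed.

(** The opposite sortings of [unbarredT] and [X] share the part [R], so the unbarred parts of their
    conversions are equivalent. The conversion of [X] is that of [Y], where the [a] in [z] is read
    first. *)
Lemma unbarred_part n : r.+1 < n -> bounded n (cells X) ->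
    sorted strip_le (bars_first unbarredT).2 ->
  knuth (rword n (bars_first unbarredT).2) (a :: rword n (bars_first barredT).2).
Proof.
move=> rn bn srt.
have [[B [U1 [U2 [eT eY]]]] [R [K1 [K2 [_ eC eX]]]]] := inert_cell.
have := bars_first_knuth (valid_flips validT) (n := n).
rewrite bounded_flips flipsK eC /= => /(_ (boundC bn)) kC.
have := bars_first_knuth (valid_flips validX) (n := n).
rewrite bounded_flips flipsK eX eqXY eY /= => /(_ bn) kX.
have uC : uniq (cells (bars_first unbarredT).2).
  by have := valid_uniq (bars_first_valid validT); rewrite /cells map_cat cat_uniq => /and3P[].
have uY : uniq (cells (U1 ++ (z, (false, a)) :: U2)).
  have := valid_uniq (bars_first_valid validX); rewrite eqXY eY /=.
  by rewrite /cells map_cat cat_uniq => /and3P[].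
have le : letters (bars_first unbarredT).2 = letters (U1 ++ (z, (false, a)) :: U2).
  have := (letters_bars_first X).2; rewrite eqXY eY /= => ->.
  rewrite (letters_bars_first _).2 /unbarredT /X !letters_cat !filter_cat /=.
  by [].
have k := strip_knuth uC srt le (knuth_trans (knuth_sym kC) kX).
apply: (knuth_trans k); rewrite eT (rword_insert_bottom rn _ uY) //=.
  exact: knuth_refl.
apply: cells_rows => c cU; rewrite -cellsT -(mem_bars_first barredT) eT.
by rewrite /cells map_cat mem_cat -/(cells _) -/(cells _) cU orbT.
Qed.

(** The conversions of [barredT] and [X] share the barred part [B]. The opposite sorting of [X] is
    that of [unbarredT] with the [a] of [z] inserted, which in the transposed diagram is read
    last. *)
Lemma barred_part n : r.+1 < n -> bounded n (cells X) ->
    sorted strip_le (bars_first (flips unbarredT)).2 ->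
    {in s1, forall e, unbar e.2 <= a} ->
    {in s2, forall e, barred e.2 -> a < unbar e.2} ->
  knuth (rcons (rword n (flips (bars_first unbarredT).1)) a)
    (rword n (flips (bars_first barredT).1)).
Proof.
move=> rn bn srt le1 le2.
have [[B [U1 [U2 [eT eY]]]] [R [K1 [K2 [eK eC eX]]]]] := inert_cell.
have kC := bars_first_knuth validT (boundC bn).
have := bars_first_knuth validX bn.
rewrite eqXY eY eX eT /= => kX; rewrite eC /= in srt kC.
have sub c : c \in cells (K1 ++ K2) -> c.2 < r.+1.
  move=> cK; rewrite ltnS.
  have : c \in cells (flips unbarredT).
    by rewrite -mem_bars_first eC /cells map_cat mem_cat -/(cells _) -/(cells _) cK orbT.
  by rewrite cells_flips => /mapP[d /rows dr ->].
have uX : uniq (cells (K1 ++ flip (z, (true, a)) :: K2)).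
  have := valid_uniq (bars_first_valid (valid_flips validX)); rewrite eX.
  by rewrite /cells map_cat cat_uniq => /and3P[].
have uC : uniq (cells (K1 ++ K2)).
  have := valid_uniq (bars_first_valid (valid_flips validT)); rewrite eC.
  by rewrite /cells map_cat cat_uniq => /and3P[].
have lC : letters (K1 ++ K2) = letters (flips (bars_first unbarredT).1).
  by rewrite letters_flips_bars_first eC.
have lX : letters (K1 ++ flip (z, (true, a)) :: K2) = letters (flips B).
  by have := letters_flips_bars_first X; rewrite eX eqXY eY.
have eK2 : letters K2 = [seq x <- letters (flips s2) | ~~ barred x].
  have := (letters_bars_first (flips unbarredT)).2; rewrite eC /=.
  rewrite flips_cat !letters_cat filter_cat eK /= => /eqP.
  by rewrite eqseq_cat // eqxx => /eqP.
(* The letters of [K1] come from [s1], so they are at most [a], and their transposed cells are left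
   of that of [z]; those of [K2] come from [s2] and exceed [a]. *)
have srtX : sorted strip_le (K1 ++ flip (z, (true, a)) :: K2).
  move: srt; rewrite !(sorted_pairwise strip_le_trans) !pairwise_cat /=.
  rewrite allrel_consr => /and3P[-> -> ->]; rewrite !andbT /=.
  apply/andP; split; apply/allP => e eKi; have := map_f snd eKi.
    rewrite -/(letters _) eK mem_filter => /andP[_ /mapP[f /mapP[g gs ->] ef]].
    have := le1 g gs; have := sub e.1; rewrite /strip_le /cells map_f ?mem_cat ?eKi //.
    by rewrite ef /= => /(_ isT) ->; rewrite andbT orbC -leq_eqVlt.
  rewrite -/(letters _) eK2 mem_filter => /andP[he /mapP[f /mapP[g gs eg] ef]].
  rewrite /strip_le ef eg /= le2 //.
  by move: he; rewrite ef eg negbK.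
have kX' := strip_knuth uX srtX lX (knuth_sym kX).
rewrite (rword_insert_right rn _ uX) //= -cats1 in kX'.
have := strip_knuth uC srt lC (knuth_sym kC).
move/(knuth_catr [:: a])/knuth_sym; rewrite cats1 => /knuth_trans; exact.
Qed.

End Toggle.

Lemma blft_word_C_minus T : colored_tableau natural_le T -> barred (southwest T) ->
  knuth (blft_word T) (blft_word (C_minus T)).
Proof.
move=> TC hb; have T0 : 0 < size T by case: T hb {TC}.
have [s cs] := chain_exists TC.
have swD := southwest_diagram (ct_straight TC) T0.
set sw := ((size T).-1, 0) in swD.
have [a ea] : exists a, southwest T = (true, a).
  by case: (southwest T) hb => [[] a] // _; exists a.
have sws : (sw, (true, a)) \in s.
  move: swD; rewrite (chain_realizes cs).1 => /mapP[e es ee].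
  rewrite -ea /southwest -/sw ee (chain_realizes cs).2 //.
  by rewrite -surjective_pairing.
case/splitPr: sws cs => s1 s2 cs.
have [cC lt2] := chain_C_minus T0 cs.
have [n rn bn] := exists_bound (cells (s1 ++
  [:: (sw, (false, a)), ((size T).-1.+1, 0, (true, a)) & s2])) (size T).-1.+1.
have bnT : bounded n (cells (s1 ++ (sw, (true, a)) :: s2)).
  apply/allP => c cC'; apply: (allP bn); move: cC'.
  by rewrite /cells !map_cat !mem_cat /= !inE => /or3P[] ->; rewrite ?orbT.
have bnC : bounded n (cells (s1 ++ (sw, (false, a)) :: s2)).
  by move: bnT; rewrite /cells !map_cat.
rewrite (blft_word_chain cs bnT) (blft_word_chain cC bnC).
have rows : {in cells (s1 ++ (sw, (false, a)) :: s2), forall c, c.1 <= (size T).-1}.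
  move=> c cC'; rewrite -ltnS prednK //; apply: in_diagram_size.
  by rewrite (chain_realizes cs).1; move: cC'; rewrite /cells !map_cat.
have [_ V P S] := cC.
have P1 : all (fun e => 0 < unbar e.2) s1 by move: P; rewrite all_cat => /andP[].
have P2 : all (fun e => 0 < unbar e.2) s2 by move: P; rewrite all_cat /= => /and3P[].
have a0 : 0 < a by move: P; rewrite all_cat /= => /and3P[].
have kU := unbarred_part V rows rn bn (chain_strip V P S).
have le1 : {in s1, forall e, unbar e.2 <= a}.
  move=> e es; have [_ _ _] := cs.
  rewrite pairwise_cat allrel_consr => /andP[/andP[/allP /(_ e es) + _] _].
  rewrite /= /chain_lt /ltk !rank1E //= ?(allP P1) //.
  by case/orP=> [|/andP[/eqP-> //]]; case: (barred e.2) => /=; clear; lia.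
have le2 : {in s2, forall e, barred e.2 -> a < unbar e.2}.
  move=> e es he; have := lt2 e es; rewrite /ltk !rank1E ?(allP P2) // he /=.
  by move: a0; clear; lia.
have kB := barred_part V rows rn bn (chain_strip_flips V P S) le1 le2.
(* The common word is the barred part for [C_minus T], then [a], then the unbarred part for [T]. *)
apply: (knuth_trans (knuth_catr _ (knuth_sym kB))).
rewrite cat_rcons; apply: knuth_catl; exact: knuth_sym.
Qed.

Unset Implicit Arguments.

Theorem theorem3p3 (T : filling) :
  colored_tableau natural_le T -> barred (southwest T) ->
  blft T = blft (C_minus T).
Proof.
move=> TC hb; have k := blft_word_C_minus TC hb; rewrite /blft.
(* Knuth equivalent words define the same predicate, so [epsilon] makes the same choice. *)
congr (epsilon _ _); apply: functional_extensionality => P.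
apply: propositional_extensionality; split=> -[sP kP]; split=> //.
  exact: knuth_trans kP k.
exact: knuth_trans kP (knuth_sym k).
Qed.
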